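(* Let $R$ be a real closed field and let $X$ be a geometrically integral variety over $R$. Then $ob(X)=0$ if and only if the natural map ${\rm Br}\, R\to {\rm Br}\, R(X)$ is injective.
   Context: A field $R$ is real closed if $-1$ is not a sum of squares in $R$ but is a sum of squares in every proper finite extension of $R$. Let $\overline{R}$ be an algebraic closure and $\mathfrak{g}={\rm Gal}(\overline{R}/R)$. For a geometrically integral $R$-variety $X$, $\overline{R}(X)$ is the function field of $X\times_R\overline{R}$ and $R(X)$ that of $X$. The elementary obstruction $ob(X)\in{\rm Ext}^1_{\mathfrak{g}}(\overline{R}(X)^*/\overline{R}^*,\overline{R}^* )$ is the class of the extension of Galois modules $1\to\overline{R}^*\to\overline{R}(X)^*\to\overline{R}(X)^*/\overline{R}^*\to1$; $ob(X)=0$ iff $\overline{R}^*\hookrightarrow\overline{R}(X)^*$ has a Galois-equivariant retraction. *)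

(* Defs.v *)
From HB Require Import structures.
From mathcomp Require Import all_boot all_order all_algebra all_field.
From mathcomp Require Import generic_quotient ring_quotient boolp.

Set Implicit Arguments.
Unset Strict Implicit.
Unset Printing Implicit Defensive.

Import GRing.Theory.
Local Open Scope ring_scope.

(* An integral separated k-scheme of finite type is encoded by its Chevalley  *)
(* schema (EGA I, 8.3): the function field K over k, and the local rings of   *)
(* its points as subrings of K. These local rings are given by an atlas,      *)
(* i.e., by finitely many affine charts Spec A with A a finitely generated    *)
(* k-subalgebra of K such that Frac A = K.                                    *)
(* Subrings and ideals are predicates K -> Prop.                              *)

Section Subrings.
Variables (k K : fieldType) (i : {rmorphism k -> K}).

(* The k-subalgebra k[g] of K; opposites come from the scalar -1. *)
Inductive subalg_gen (g : seq K) : K -> Prop :=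
| SubalgScalar c : subalg_gen g (i c)
| SubalgGen x : x \in g -> subalg_gen g x
| SubalgAdd x y : subalg_gen g x -> subalg_gen g y -> subalg_gen g (x + y)
| SubalgMul x y : subalg_gen g x -> subalg_gen g y -> subalg_gen g (x * y).

End Subrings.

Section LocalRings.
Variable K : fieldType.
Implicit Types A P O B : K -> Prop.

Definition fraction_field_of A : Prop :=
  forall z : K, exists x y, [/\ A x, A y, y != 0 & z = x / y].

Record prime_ideal_of A P : Prop := PrimeIdealOf {
  prime_sub : forall x, P x -> A x;
  prime_zero : P 0;
  prime_add : forall x y, P x -> P y -> P (x + y);
  prime_mul : forall a x, A a -> P x -> P (a * x);
  prime_proper : ~ P 1;
  prime_prime : forall x y, A x -> A y -> P (x * y) -> P x \/ P y
}.

Definition localization A P : K -> Prop :=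
  fun z => exists x y, [/\ A x, A y, ~ P y & z = x / y].

Definition nonunit O : K -> Prop := fun x => O x /\ ~ (x != 0 /\ O x^-1).

Record local_subring O : Prop := LocalSubring {
  local_one : O 1;
  local_sub : forall x y, O x -> O y -> O (x - y);
  local_mul : forall x y, O x -> O y -> O (x * y);
  local_nonunit : forall x y, nonunit O x -> nonunit O y -> nonunit O (x + y)
}.

Definition dominates B O : Prop :=
  (forall x, O x -> B x) /\ (forall x, nonunit O x -> nonunit B x).

Definition allied O1 O2 : Prop :=
  exists B, [/\ local_subring B, dominates B O1 & dominates B O2].

End LocalRings.

Section Atlas.
Variables (k K : fieldType) (i : {rmorphism k -> K}) (charts : seq (seq K)).

Definition is_point (O : K -> Prop) : Prop :=
  exists g P, [/\ g \in charts, prime_ideal_of (subalg_gen i g) P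
                & O = localization (subalg_gen i g) P].

(* Two points whose local rings are dominated by a common local ring are      *)
(* equal: this is both the separatedness and the gluing condition.            *)
Definition separated_atlas : Prop :=
  forall O1 O2, is_point O1 -> is_point O2 -> allied O1 O2 -> O1 = O2.

End Atlas.

Record variety (k : fieldType) := Variety {
  funfield : fieldType;
  fconst : {rmorphism k -> funfield};
  atlas : seq (seq funfield);
  atlas_nonempty : atlas != [::];
  atlas_frac : forall g, g \in atlas -> fraction_field_of (subalg_gen fconst g);
  atlas_separated : separated_atlas fconst atlas
}.

Definition algebraic_closure (k : fieldType) (C : closedFieldType)
    (s : {rmorphism k -> C}) : Prop :=
  forall x : C, algebraicOver s x.

Definition lin_indep (k K : fieldType) (i : {rmorphism k -> K}) n
    (a : 'I_n -> K) : Prop :=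
  forall r : 'I_n -> k, \sum_j i (r j) * a j = 0 -> forall j, r j = 0.

(* X x_k C is covered by the spectra of the rings A (x)_k C for the charts A  *)
(* of X. It is integral, with function field L, when each A (x)_k C is a      *)
(* domain with fraction field L, i.e., when the map A (x)_k C -> L is         *)
(* injective (geom_disjoint) and L is the fraction field of its image, which  *)
(* is the C-algebra generated by A (geom_frac). Such data exist if and only   *)
(* if X is geometrically integral, and are then unique up to a unique         *)
(* isomorphism.                                                               *)
Record geom_integral (k : fieldType) (C : closedFieldType)
    (s : {rmorphism k -> C}) (X : variety k) := GeomIntegral {
  geom_funfield : fieldType;
  geom_pull : {rmorphism funfield X -> geom_funfield};
  geom_const : {rmorphism C -> geom_funfield};
  geom_compat : forall c, geom_pull (fconst X c) = geom_const (s c);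
  geom_disjoint : forall g, g \in atlas X ->
    forall n (a : 'I_n -> funfield X),
      (forall j, subalg_gen (fconst X) g (a j)) -> lin_indep (fconst X) a ->
    forall c : 'I_n -> C,
      \sum_j geom_const (c j) * geom_pull (a j) = 0 -> forall j, c j = 0;
  geom_frac : forall g, g \in atlas X ->
    fraction_field_of (subalg_gen geom_const (map geom_pull g))
}.

Definition is_gal (k C : fieldType) (s : {rmorphism k -> C}) (f : C -> C) :=
  [/\ zmod_morphism f, monoid_morphism f, bijective f
    & forall a, f (s a) = s a].

Section Galois.
Variables (k C : fieldType) (s : {rmorphism k -> C}).

Definition gal : Type := {f : C -> C | `[< is_gal s f >]}.
HB.instance Definition _ := SubType.on gal.
HB.instance Definition _ := [Choice of gal by <:].

Lemma galP (u : gal) : is_gal s (val u).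
Proof. exact/asboolP/(valP u). Qed.

Lemma gal_sub (u : gal) : zmod_morphism (val u).
Proof. by have [] := galP u. Qed.
Lemma gal_mon (u : gal) : monoid_morphism (val u).
Proof. by have [] := galP u. Qed.

Lemma is_gal_id : is_gal s idfun.
Proof. by split=> //; exists idfun. Qed.

Lemma is_gal_comp f h : is_gal s f -> is_gal s h -> is_gal s (f \o h).
Proof.
move=> [fB [f1 fM] fb fs] [hB [h1 hM] hb hs]; split=> /=.
- by move=> x y /=; rewrite hB fB.
- by split=> [|x y] /=; rewrite ?h1 ?f1 // hM fM.
- exact: bij_comp.
- by move=> a /=; rewrite hs fs.
Qed.

Lemma is_gal_inv f h : is_gal s f -> cancel f h -> cancel h f -> is_gal s h.
Proof.
move=> [fB [f1 fM] fb fs] fK hK; have fI := can_inj fK; split.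
- by move=> x y; apply: fI; rewrite fB !hK.
- by split=> [|x y]; apply: fI; rewrite ?fM !hK ?f1.
- by exists f.
- by move=> a; apply: fI; rewrite fs hK.
Qed.

Lemma gal_inv_subproof (u : gal) :
  exists v : gal, cancel (val u) (val v) /\ cancel (val v) (val u).
Proof.
have uP := galP u; have [_ _ [h uK hK] _] := uP.
by exists (Sub h (asboolT (is_gal_inv uP uK hK))).
Qed.

Definition gal_one : gal := Sub idfun (asboolT is_gal_id).
Definition gal_mul (u v : gal) : gal :=
  Sub (val u \o val v) (asboolT (is_gal_comp (galP u) (galP v))).
Definition gal_inv (u : gal) : gal := projT1 (cid (gal_inv_subproof u)).

Lemma gal_mulA : associative gal_mul. Proof. by move=> u v w; apply/val_inj. Qed.
Lemma gal_mul1 : left_id gal_one gal_mul. Proof. by move=> u; apply/val_inj. Qed.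
Lemma gal_mulr1 : right_id gal_one gal_mul. Proof. by move=> u; apply/val_inj. Qed.
Lemma gal_mulV : left_inverse gal_one gal_inv gal_mul.
Proof.
move=> u; apply/val_inj/funext=> x /=; rewrite /gal_inv.
by case: cid => v [uK _] /=; rewrite uK.
Qed.
Lemma gal_mulrV : right_inverse gal_one gal_inv gal_mul.
Proof.
move=> u; apply/val_inj/funext=> x /=; rewrite /gal_inv.
by case: cid => v [_ vK] /=; rewrite vK.
Qed.

HB.instance Definition _ :=
  isGroup.Build gal gal_mulA gal_mul1 gal_mulr1 gal_mulV gal_mulrV.

End Galois.

Section GaloisAction.
Variables (k : fieldType) (C : closedFieldType) (s : {rmorphism k -> C}).
Variables (X : variety k) (Xg : geom_integral s X).
Local Notation K := (funfield X).
Local Notation L := (geom_funfield Xg).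
Local Notation j := (geom_pull Xg).
Local Notation ic := (geom_const Xg).

Definition extends_gal (u : gal s) (t : L -> L) : Prop :=
  [/\ zmod_morphism t, monoid_morphism t, forall x, t (j x) = j x
    & forall c, t (ic c) = ic (val u c)].

Let g0 : seq K := head [::] (atlas X).
Let g0P : g0 \in atlas X.
Proof. by rewrite /g0; case: (atlas X) (atlas_nonempty X) => //= g l; rewrite mem_head. Qed.
Local Notation A := (subalg_gen (fconst X) g0).

Definition galX (u : gal s) : {rmorphism C -> C} :=
  HB.pack_for (GRing.RMorphism.type C C) (val u)
    (GRing.isZmodMorphism.Build C C (val u) (gal_sub u))
    (GRing.isMonoidMorphism.Build C C (val u) (gal_mon u)).

Lemma galXE u : galX u =1 val u. Proof. by []. Qed.

Lemma gal_rel0 (u : gal s) n (a : 'I_n -> K) (c : 'I_n -> C) :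
  (forall q, A (a q)) ->
  \sum_q ic (c q) * j (a q) = 0 -> \sum_q ic (galX u (c q)) * j (a q) = 0.
Proof.
elim: n a c => [|n IHn] a c Aa; first by rewrite !big_ord0.
have [ai|/existsNP[r /not_implyP[r0 /existsNP[q rq]]]] := pselect (lin_indep (fconst X) a).
  move=> /(geom_disjoint g0P Aa ai) c0.
  by rewrite big1 // => q _; rewrite c0 !rmorph0 mul0r.
move/eqP in rq.
have aq : a q = \sum_p fconst X (- (r (lift q p) / r q)) * a (lift q p).
  have fr : fconst X (r q) != 0 by rewrite fmorph_eq0.
  apply: (mulfI fr); move: r0; rewrite (bigD1_ord q) //= => /eqP.
  rewrite addr_eq0 => /eqP->; rewrite mulr_sumr -sumrN.
  apply: eq_bigr => p _; rewrite mulrA -rmorphM mulrN mulrCA divff // mulr1.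
  by rewrite rmorphN mulNr.
pose c' p := c (lift q p) + c q * s (- (r (lift q p) / r q)).
have red (f : {rmorphism C -> C}) : (forall x, f (s x) = s x) ->
    \sum_p ic (f (c p)) * j (a p) = \sum_p ic (f (c' p)) * j (a (lift q p)).
  move=> fs; rewrite (bigD1_ord q) //= {1}aq rmorph_sum mulr_sumr -big_split /=.
  apply: eq_bigr => p _; rewrite /c' rmorphD [f (_ * _)]rmorphM fs rmorphD.
  by rewrite [ic (_ * _)]rmorphM -geom_compat rmorphM mulrDl addrC mulrA.
rewrite (red idfun) // => /(IHn _ _ (fun p => Aa _)).
by rewrite -red // => x; rewrite galXE; have [_ _ _ ->] := galP u.
Qed.

Let ev (f : C -> C) (l : seq (C * K)) : L := \sum_(p <- l) ic (f p.1) * j p.2.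
Let inA (l : seq (C * K)) := forall p, p \in l -> A p.2.
Let mulL (l l' : seq (C * K)) := [seq (p.1 * q.1, p.2 * q.2) | p <- l, q <- l'].

Let ev_cat f l l' : ev f (l ++ l') = ev f l + ev f l'.
Proof. by rewrite /ev big_cat. Qed.

Let ev_mul (f : {rmorphism C -> C}) l l' : ev f (mulL l l') = ev f l * ev f l'.
Proof.
rewrite /ev big_allpairs_dep mulr_suml; apply: eq_bigr => p _ /=.
by rewrite mulr_sumr; apply: eq_bigr => q _; rewrite !rmorphM mulrACA.
Qed.

Let ev_map f h l : ev f [seq (h p.1, p.2) | p <- l] = ev (f \o h) l.
Proof. by rewrite /ev big_map. Qed.

Let inA_cat l l' : inA l -> inA l' -> inA (l ++ l').
Proof. by move=> Al Al' p; rewrite mem_cat => /orP[/Al|/Al']. Qed.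

Let inA_mul l l' : inA l -> inA l' -> inA (mulL l l').
Proof.
by move=> Al Al' p /allpairsP[[x y] /= [/Al ? /Al' ? ->]]; apply: SubalgMul.
Qed.

Let inA_map h l : inA l -> inA [seq (h p.1, p.2) | p <- l].
Proof. by move=> Al p /mapP[q /Al qA ->]. Qed.

Let ev0 (u : gal s) l : inA l -> ev id l = 0 -> ev (galX u) l = 0.
Proof.
move=> Al; rewrite /ev !(big_tnth _ _ l) => l0.
apply: (@gal_rel0 u _ (fun q => (tnth (in_tuple l) q).2)
                      (fun q => (tnth (in_tuple l) q).1)) => // q.
by apply: Al; apply: mem_tnth.
Qed.

Let ev_eq0 (u : gal s) l : inA l -> (ev (galX u) l == 0) = (ev id l == 0).
Proof.
move=> Al; apply/eqP/eqP => [l0|]; last exact: ev0.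
have := @ev0 u^-1%g _ (@inA_map (galX u) _ Al); rewrite !ev_map => /(_ l0).
rewrite /ev => l1; rewrite -[RHS]l1; apply: eq_bigr => p _.
congr (ic _ * _); exact/esym/(congr1 (fun v : gal s => val v p.1) (mulVg u)).
Qed.

Let ev_opp (f : {rmorphism C -> C}) l :
  ev f [seq (- p.1, p.2) | p <- l] = - ev f l.
Proof.
by rewrite ev_map /ev -sumrN; apply: eq_bigr => p _ /=; rewrite !rmorphN mulNr.
Qed.

Let ev_onto x : subalg_gen ic (map j g0) x -> exists2 l, inA l & x = ev id l.
Proof.
elim=> [c|y /mapP[z zg ->]|y z _ [l Al ->] _ [l' Al' ->]|y z _ [l Al ->] _ [l' Al' ->]].
- exists [:: (c, 1)]; last by rewrite /ev big_seq1 rmorph1 mulr1.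
  by move=> p; rewrite inE => /eqP-> /=; rewrite -(rmorph1 (fconst X)); constructor.
- exists [:: (1, z)]; last by rewrite /ev big_seq1 rmorph1 mul1r.
  by move=> p; rewrite inE => /eqP-> /=; constructor.
- by exists (l ++ l'); [apply: inA_cat | rewrite ev_cat].
- by exists (mulL l l'); [apply: inA_mul | rewrite (ev_mul idfun)].
Qed.

Let gal_graph (u : gal s) (z w : L) : Prop := exists l l',
  [/\ inA l, inA l', ev id l' != 0, z = ev id l / ev id l'
    & w = ev (galX u) l / ev (galX u) l'].

Let graph_total u z : exists w, gal_graph u z w.
Proof.
have [x [y [/ev_onto[l Al ->] /ev_onto[l' Al' ->] y0 ->]]] := geom_frac g0P z.
by exists (ev (galX u) l / ev (galX u) l'), l, l'.
Qed.

Let graph_eq u l l' m m' : inA l -> inA l' -> inA m -> inA m' ->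
  ev id l' != 0 -> ev id m' != 0 -> ev id l / ev id l' = ev id m / ev id m' ->
  ev (galX u) l / ev (galX u) l' = ev (galX u) m / ev (galX u) m'.
Proof.
move=> Al Al' Am Am' l0 m0 /eqP; rewrite eqr_div // => /eqP e.
apply/eqP; rewrite eqr_div ?ev_eq0 //.
rewrite -!ev_mul -subr_eq0 -ev_opp -ev_cat ev_eq0; last first.
  by apply: inA_cat; [|apply: inA_map]; apply: inA_mul.
by rewrite ev_cat (ev_opp idfun) !(ev_mul idfun) e subrr.
Qed.

Let graph_fun u z w w' : gal_graph u z w -> gal_graph u z w' -> w = w'.
Proof.
move=> [l [l' [Al Al' l0 -> ->]]] [m [m' [Am Am' m0 e ->]]].
exact: graph_eq.
Qed.

Let graph_sub u z w z' w' :
  gal_graph u z w -> gal_graph u z' w' -> gal_graph u (z - z') (w - w').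
Proof.
move=> [l [l' [Al Al' l0 -> ->]]] [m [m' [Am Am' m0 -> ->]]].
exists (mulL l m' ++ [seq (- p.1, p.2) | p <- mulL m l']), (mulL l' m').
have e (f : {rmorphism C -> C}) : ev f l' != 0 -> ev f m' != 0 ->
    ev f l / ev f l' - ev f m / ev f m' =
    ev f (mulL l m' ++ [seq (- p.1, p.2) | p <- mulL m l']) / ev f (mulL l' m').
  by move=> fl fm; rewrite ev_cat ev_opp !ev_mul -mulNr addf_div // mulNr.
split.
- by apply: inA_cat; [|apply: inA_map]; apply: inA_mul.
- exact: inA_mul.
- by rewrite (ev_mul idfun) mulf_neq0.
- by rewrite -(e idfun).
- by rewrite -e // ev_eq0.
Qed.

Let graph_mul u z w z' w' :
  gal_graph u z w -> gal_graph u z' w' -> gal_graph u (z * z') (w * w').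
Proof.
move=> [l [l' [Al Al' l0 -> ->]]] [m [m' [Am Am' m0 -> ->]]].
exists (mulL l m), (mulL l' m'); split; try exact: inA_mul.
- by rewrite (ev_mul idfun) mulf_neq0.
- by rewrite !(ev_mul idfun) mulf_div.
- by rewrite !ev_mul mulf_div.
Qed.

Let A1 : A 1. Proof. by rewrite -(rmorph1 (fconst X)); constructor. Qed.

Let inA1 c x : A x -> inA [:: (c, x)].
Proof. by move=> Ax p; rewrite inE => /eqP->. Qed.

Let ev1 (f : C -> C) c x : ev f [:: (c, x)] = ic (f c) * j x.
Proof. by rewrite /ev big_seq1. Qed.

Let graph_const u c : gal_graph u (ic c) (ic (galX u c)).
Proof.
exists [:: (c, 1)], [:: (1, 1)]; rewrite !ev1 !rmorph1 !mulr1 !divr1 oner_neq0.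
by split=> //; apply: inA1.
Qed.

Let graph_pull u x : gal_graph u (j x) (j x).
Proof.
have [y [z [Ay Az z0 ->]]] := atlas_frac g0P x.
exists [:: (1, y)], [:: (1, z)]; rewrite !ev1 !rmorph1 !mul1r fmorph_div.
by split=> //; [exact: inA1 | exact: inA1 | rewrite fmorph_eq0].
Qed.

Lemma extends_gal_exists (u : gal s) : exists t : L -> L, extends_gal u t.
Proof.
pose t z := projT1 (cid (graph_total u z)).
have tP z : gal_graph u z (t z) by rewrite /t; case: cid.
exists t; split.
- by move=> x y; apply: (graph_fun (tP _)); apply: graph_sub.
- split=> [|x y].
    by have := graph_const u 1; rewrite !rmorph1; apply: graph_fun.
  by apply: (graph_fun (tP _)); apply: graph_mul.
- by move=> x; apply: (graph_fun (tP _)).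
- by move=> c; rewrite -galXE; apply: (graph_fun (tP _)).
Qed.

Lemma extends_gal_unique (u : gal s) t t' :
  extends_gal u t -> extends_gal u t' -> t = t'.
Proof.
move=> [tB tM tj tc] [tB' tM' tj' tc'].
pose f : GRing.RMorphism.type L L := HB.pack t
  (GRing.isZmodMorphism.Build L L t tB) (GRing.isMonoidMorphism.Build L L t tM).
pose f' : GRing.RMorphism.type L L := HB.pack t'
  (GRing.isZmodMorphism.Build L L t' tB') (GRing.isMonoidMorphism.Build L L t' tM').
have e x : subalg_gen ic (map j g0) x -> f x = f' x.
  elim=> [c|y /mapP[z _ ->]|y z _ yE _ zE|y z _ yE _ zE].
  - by rewrite /f /f' /= tc tc'.
  - by rewrite /f /f' /= tj tj'.
  - by rewrite !rmorphD yE zE.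
  - by rewrite !rmorphM yE zE.
apply/funext=> z; have [x [y [Ax Ay _ ->]]] := geom_frac g0P z.
by rewrite -[LHS]/(f _) -[RHS]/(f' _) !fmorph_div !e.
Qed.

Definition gal_act (u : gal s) : L -> L := projT1 (cid (extends_gal_exists u)).

Lemma gal_actP u : extends_gal u (gal_act u).
Proof. by rewrite /gal_act; case: cid. Qed.

Lemma gal_act1 x : gal_act 1%g x = x.
Proof.
suff -> : gal_act 1%g = idfun by [].
by apply: extends_gal_unique (gal_actP _) _; split.
Qed.

Lemma gal_actM u v x : gal_act (u * v)%g x = gal_act u (gal_act v x).
Proof.
suff -> : gal_act (u * v)%g = gal_act u \o gal_act v by [].
apply: extends_gal_unique (gal_actP _) _.
have [uB [u1 uM] uj uc] := gal_actP u; have [vB [v1 vM] vj vc] := gal_actP v.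
split=> /=.
- by move=> y z /=; rewrite vB uB.
- by split=> [|y z] /=; rewrite ?v1 ?u1 // vM uM.
- by move=> y; rewrite vj uj.
- by move=> c; rewrite vc uc.
Qed.

End GaloisAction.
Arguments gal_act {k C s X} Xg u x.

Record gmod (G : groupType) := GMod {
  gmod_car :> zmodType;
  gact : G -> gmod_car -> gmod_car;
  gact_sub : forall g, zmod_morphism (gact g);
  gact_one : forall x, gact 1%g x = x;
  gact_mul : forall g h x, gact (g * h)%g x = gact g (gact h x)
}.

Record ghom (G : groupType) (M N : gmod G) := GHom {
  ghom_fun :> M -> N;
  ghom_sub : zmod_morphism ghom_fun;
  ghom_act : forall g x, ghom_fun (gact g x) = gact g (ghom_fun x)
}.

(* Extensions 0 -> N -> E -> M -> 0, M being the first argument as in         *)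
(* Ext^1(M, N).                                                               *)
Record extension (G : groupType) (M N : gmod G) := Extension {
  ext_mod : gmod G;
  ext_in : ghom N ext_mod;
  ext_out : ghom ext_mod M;
  ext_inj : injective ext_in;
  ext_surj : forall y, exists x, ext_out x = y;
  ext_exact : forall x, ext_out x = 0 <-> exists y, ext_in y = x
}.

Definition ext_equiv (G : groupType) (M N : gmod G) (e e' : extension M N) :=
  exists f : ghom (ext_mod e) (ext_mod e'),
    [/\ bijective f, forall y, f (ext_in e y) = ext_in e' y
      & forall x, ext_out e' (f x) = ext_out e x].

(* The Yoneda Ext^1, as the set of equivalence classes of extensions; its zero *)
(* is the class of the split extension.                                       *)
Definition Ext1 (G : groupType) (M N : gmod G) : Type :=
  {c : extension M N -> Prop | exists e, c = ext_equiv e}.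

Definition ext_class (G : groupType) (M N : gmod G) (e : extension M N) :
  Ext1 M N := exist _ (ext_equiv e) (ex_intro _ e erefl).

Section Split.
Variables (G : groupType) (M N : gmod G).

Definition sum_act (g : G) (x : N * M) : N * M := (gact g x.1, gact g x.2).

Lemma sum_act_sub g : zmod_morphism (sum_act g).
Proof. by move=> x y; rewrite /sum_act /= !gact_sub. Qed.
Lemma sum_act1 x : sum_act 1%g x = x.
Proof. by rewrite /sum_act !gact_one -surjective_pairing. Qed.
Lemma sum_actM g h x : sum_act (g * h)%g x = sum_act g (sum_act h x).
Proof. by rewrite /sum_act /= !gact_mul. Qed.

Definition sum_gmod : gmod G :=
  @GMod G (N * M)%type sum_act sum_act_sub sum_act1 sum_actM.

Lemma gact0 (P : gmod G) g : gact g (0 : P) = 0.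
Proof. by have := gact_sub g (0 : P) 0; rewrite !subrr. Qed.

Lemma sum_in_sub : zmod_morphism (fun x : N => (x, 0) : sum_gmod).
Proof. by move=> x y; rewrite -[RHS]/(x - y, 0 - 0) subrr. Qed.
Lemma sum_in_act g (x : N) : ((gact g x, 0) : sum_gmod) = gact g ((x, 0) : sum_gmod).
Proof. by rewrite /= /sum_act gact0. Qed.
Definition sum_in : ghom N sum_gmod := GHom sum_in_sub sum_in_act.

Lemma sum_out_sub : zmod_morphism (fun x : sum_gmod => x.2).
Proof. by []. Qed.
Lemma sum_out_act g (x : sum_gmod) : (gact g x).2 = gact g x.2.
Proof. by []. Qed.
Definition sum_out : ghom sum_gmod M := GHom sum_out_sub sum_out_act.

Lemma split_inj : injective sum_in. Proof. by move=> x y []. Qed.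
Lemma split_surj y : exists x, sum_out x = y. Proof. by exists (0, y). Qed.
Lemma split_exact x : sum_out x = 0 <-> exists y, sum_in y = x.
Proof.
by case: x => x y; split=> /= [->|[z [_ <-]]//]; exists x.
Qed.

Definition split_ext : extension M N := Extension split_inj split_surj split_exact.

End Split.

Definition Ext1_zero (G : groupType) (M N : gmod G) : Ext1 M N :=
  ext_class (split_ext M N).

Section Cokernel.
Local Open Scope quotient_scope.
Variables (G : groupType) (N E : gmod G) (f : ghom N E).
Hypothesis f_inj : injective f.

Definition im_pred : pred E := fun x => `[< exists y, f y = x >].

Lemma im_zmod_closed : zmod_closed im_pred.
Proof.
split=> [|_ _ /asboolP[x <-] /asboolP[y <-]]; apply/asboolP.
  by exists 0; have := ghom_sub f 0 0; rewrite !subrr.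
by exists (x - y); rewrite ghom_sub.
Qed.
Definition im_closed : zmodClosed E := HB.pack_for (zmodClosed E) im_pred
  (GRing.isZmodClosed.Build E im_pred im_zmod_closed).

Local Notation Q := (Quotient.quot im_closed).

Definition coker_proj (x : E) : Q := \pi x.

Lemma coker_proj_sub : zmod_morphism coker_proj.
Proof. exact: raddfB. Qed.
Lemma coker_projK : cancel repr coker_proj.
Proof. exact: reprK. Qed.
Lemma coker_projP (x y : E) :
  coker_proj x = coker_proj y <-> exists z, f z = x - y.
Proof.
split=> [/eqP|xy]; last apply/eqP; rewrite /coker_proj -Quotient.idealrBE.
  by move/asboolP.
exact/asboolP.
Qed.

Definition coker_act (g : G) (q : Q) : Q := coker_proj (gact g (repr q)).

Lemma coker_actE g x : coker_act g (coker_proj x) = coker_proj (gact g x).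
Proof.
apply/coker_projP; rewrite -gact_sub.
have /coker_projP[y fy] := coker_projK (coker_proj x).
by exists (gact g y); rewrite ghom_act fy.
Qed.

Lemma coker_act_sub g : zmod_morphism (coker_act g).
Proof.
move=> x y; rewrite -[x]coker_projK -[y]coker_projK -coker_proj_sub.
by rewrite !coker_actE gact_sub coker_proj_sub.
Qed.
Lemma coker_act1 x : coker_act 1%g x = x.
Proof. by rewrite -[x]coker_projK coker_actE gact_one. Qed.
Lemma coker_actM g h x : coker_act (g * h)%g x = coker_act g (coker_act h x).
Proof. by rewrite -[x]coker_projK !coker_actE gact_mul. Qed.

Definition coker : gmod G :=
  @GMod G Q coker_act coker_act_sub coker_act1 coker_actM.

Lemma coker_pi_act g x : (coker_proj (gact g x) : coker) = gact g (coker_proj x : coker).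
Proof. by rewrite /= coker_actE. Qed.
Definition coker_pi : ghom E coker :=
  @GHom G E coker coker_proj coker_proj_sub coker_pi_act.

Lemma coker_surj y : exists x, coker_pi x = y.
Proof. by exists (repr (y : Q)); apply: coker_projK. Qed.
Lemma coker_exact x : coker_pi x = 0 <-> exists y, f y = x.
Proof.
have p0 : coker_proj 0 = 0 by have := coker_proj_sub 0 0; rewrite !subrr.
by have := coker_projP x 0; rewrite p0 subr0.
Qed.

Definition coker_ext : extension coker N := Extension f_inj coker_surj coker_exact.

End Cokernel.

(* The group L^*, written additively. *)
Definition munits (L : fieldType) : Type := {x : L | x != 0}.
HB.instance Definition _ (L : fieldType) := SubType.on (munits L).
HB.instance Definition _ (L : fieldType) := [Choice of munits L by <:].

Section Units.
Variable L : fieldType.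
Implicit Types x y z : munits L.

Definition munit_one : munits L := Sub 1 (oner_neq0 L).
Definition munit_mul x y : munits L :=
  Sub (val x * val y) (mulf_neq0 (valP x) (valP y)).
Definition munit_inv x : munits L := Sub (val x)^-1 (invr_neq0 (valP x)).

Lemma munit_mulA : associative munit_mul.
Proof. by move=> x y z; apply/val_inj; rewrite /= mulrA. Qed.
Lemma munit_mulC : commutative munit_mul.
Proof. by move=> x y; apply/val_inj; rewrite /= mulrC. Qed.
Lemma munit_mul1 : left_id munit_one munit_mul.
Proof. by move=> x; apply/val_inj; rewrite /= mul1r. Qed.
Lemma munit_mulV : left_inverse munit_one munit_inv munit_mul.
Proof. by move=> x; apply/val_inj; rewrite /= mulVf // (valP x). Qed.

HB.instance Definition _ :=
  GRing.isZmodule.Build (munits L) munit_mulA munit_mulC munit_mul1 munit_mulV.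
End Units.

Section MUnitsMap.
Variables (L M : fieldType) (f : {rmorphism L -> M}).

Lemma munit_map_neq0 (x : munits L) : f (val x) != 0.
Proof. by rewrite fmorph_eq0 (valP x). Qed.
Definition munit_map (x : munits L) : munits M := Sub (f (val x)) (munit_map_neq0 x).

Lemma munit_map_sub : zmod_morphism munit_map.
Proof. by move=> x y; apply/val_inj; rewrite /= rmorphM fmorphV. Qed.
End MUnitsMap.

Section ElementaryObstruction.
Variables (k : fieldType) (C : closedFieldType) (s : {rmorphism k -> C}).
Variables (X : variety k) (Xg : geom_integral s X).
Local Notation L := (geom_funfield Xg).
Local Notation ic := (geom_const Xg).

Definition const_act (u : gal s) : munits C -> munits C := munit_map (galX u).

Lemma const_act1 x : const_act 1%g x = x. Proof. exact/val_inj. Qed.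
Lemma const_actM u v x : const_act (u * v)%g x = const_act u (const_act v x).
Proof. exact/val_inj. Qed.

Definition const_units : gmod (gal s) :=
  @GMod (gal s) (munits C) const_act
    (fun u => munit_map_sub (galX u)) const_act1 const_actM.

Lemma gal_act_sub (u : gal s) : zmod_morphism (gal_act Xg u).
Proof. by case: (gal_actP Xg u). Qed.
Lemma gal_act_mon (u : gal s) : monoid_morphism (gal_act Xg u).
Proof. by case: (gal_actP Xg u). Qed.
Definition gal_act_rmorphism (u : gal s) : {rmorphism L -> L} :=
  HB.pack_for (GRing.RMorphism.type L L) (gal_act Xg u)
    (GRing.isZmodMorphism.Build L L (gal_act Xg u) (gal_act_sub u))
    (GRing.isMonoidMorphism.Build L L (gal_act Xg u) (gal_act_mon u)).

Definition fun_act (u : gal s) : munits L -> munits L :=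
  munit_map (gal_act_rmorphism u).

Lemma fun_act1 x : fun_act 1%g x = x.
Proof. by apply/val_inj; rewrite /= gal_act1. Qed.
Lemma fun_actM u v x : fun_act (u * v)%g x = fun_act u (fun_act v x).
Proof. by apply/val_inj; rewrite /= gal_actM. Qed.

Definition fun_units : gmod (gal s) :=
  @GMod (gal s) (munits L) fun_act
    (fun u => munit_map_sub (gal_act_rmorphism u)) fun_act1 fun_actM.

Lemma munit_map_act (u : gal s) (x : const_units) :
  (munit_map ic (gact u x) : fun_units) = gact u (munit_map ic x : fun_units).
Proof. by apply/val_inj => /=; case: (gal_actP Xg u) => _ _ _ ->. Qed.

Definition const_incl : ghom const_units fun_units :=
  @GHom (gal s) const_units fun_units
    (munit_map ic) (munit_map_sub ic) munit_map_act.

Lemma const_incl_inj : injective const_incl.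
Proof. by move=> x y /(congr1 val) /= /fmorph_inj /val_inj. Qed.

(* The class of 1 -> C^* -> C(X)^* -> C(X)^*/C^* -> 1. *)
Definition ob : Ext1 (coker const_incl) const_units :=
  ext_class (coker_ext const_incl_inj).

End ElementaryObstruction.

(* A two-sided ideal of a unital k-algebra is a subspace. *)
Definition central_simple (k : fieldType) (A : falgType k) : Prop :=
  (forall z : A, (forall x, z * x = x * z) -> exists c : k, z = c%:A) /\
  (forall I : {vspace A},
     (forall a x, x \in I -> a * x \in I /\ x * a \in I) ->
     I = 0%VS \/ I = fullv).

(* M_m(A) and M_n(B) are isomorphic k-algebras for some m, n > 0; map_mx is   *)
(* the k-module structure on matrices with coefficients in a k-algebra.       *)
Definition brauer_equiv (k : fieldType) (A B : falgType k) : Prop :=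
  exists m n (f : {rmorphism 'M[A]_m.+1 -> 'M[B]_n.+1}), bijective f /\
    forall (c : k) M, f (map_mx ( *:%R c) M) = map_mx ( *:%R c) (f M).

(* The K-algebra A (x)_k K, as K^n with the multiplication that has the same  *)
(* structure constants as A in the basis vbasis {:A}.                         *)
Definition scalar_ext (k K : fieldType) (i : {rmorphism k -> K})
  (A : falgType k) : Type := 'rV[K]_(\dim {:A}).

Section ScalarExt.
Variables (k K : fieldType) (i : {rmorphism k -> K}) (A : falgType k).
Local Notation n := (\dim {:A}).
Local Notation e := (vbasis {:A}).
Local Notation AK := (scalar_ext i A).

HB.instance Definition _ := Vector.copy AK 'rV[K]_n.

Definition se_in (x : A) : AK := \row_p i (coord e p x).
Definition se_one : AK := se_in 1.
Definition se_mul (u v : AK) : AK :=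
  \sum_p \sum_q ((u : 'rV_n) 0 p * (v : 'rV_n) 0 q) *: se_in (e`_p * e`_q).

Lemma se_inD x y : se_in (x + y) = se_in x + se_in y.
Proof. by apply/rowP=> p; rewrite !mxE raddfD rmorphD. Qed.
Lemma se_inZ c x : se_in (c *: x) = i c *: se_in x.
Proof. by apply/rowP=> p; rewrite !mxE linearZ rmorphM. Qed.
Lemma se_in0 : se_in 0 = 0.
Proof. by apply/rowP=> p; rewrite !mxE raddf0 rmorph0. Qed.
Lemma se_in_sum (I : finType) (F : I -> A) :
  se_in (\sum_p F p) = \sum_p se_in (F p).
Proof. exact: (big_morph _ se_inD se_in0). Qed.

Lemma se_in_basis (p : 'I_n) : se_in e`_p = delta_mx 0 p.
Proof.
apply/rowP=> q; rewrite !mxE coord_free ?(basis_free (vbasisP _)) //=.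
by rewrite [p == q]eq_sym; case: (q == p); rewrite ?rmorph1 ?rmorph0.
Qed.
Lemma se_span (u : AK) : u = \sum_p (u : 'rV_n) 0 p *: se_in e`_p.
Proof.
by rewrite {1}[u]row_sum_delta; apply: eq_bigr => p _; rewrite se_in_basis.
Qed.
Lemma basis_sum (x : A) : x = \sum_p coord e p x *: e`_p.
Proof. exact/coord_vbasis/memvf. Qed.

Lemma se_mulDl : left_distributive se_mul +%R.
Proof.
move=> u v w; rewrite /se_mul -big_split; apply: eq_bigr => p _ /=.
by rewrite -big_split; apply: eq_bigr => q _ /=; rewrite !mxE mulrDl scalerDl.
Qed.
Lemma se_mulDr : right_distributive se_mul +%R.
Proof.
move=> u v w; rewrite /se_mul -big_split; apply: eq_bigr => p _ /=.
by rewrite -big_split; apply: eq_bigr => q _ /=; rewrite !mxE mulrDr scalerDl.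
Qed.
Lemma se_mulZl (c : K) u v : se_mul (c *: u) v = c *: se_mul u v.
Proof.
rewrite /se_mul scaler_sumr; apply: eq_bigr => p _; rewrite scaler_sumr.
by apply: eq_bigr => q _; rewrite !mxE scalerA mulrA.
Qed.
Lemma se_mulZr (c : K) u v : se_mul u (c *: v) = c *: se_mul u v.
Proof.
rewrite /se_mul scaler_sumr; apply: eq_bigr => p _; rewrite scaler_sumr.
by apply: eq_bigr => q _; rewrite !mxE scalerA mulrCA.
Qed.
Lemma se_mul0l v : se_mul 0 v = 0.
Proof. by rewrite -[X in se_mul X _](scale0r (0 : AK)) se_mulZl scale0r. Qed.
Lemma se_mul0r v : se_mul v 0 = 0.
Proof. by rewrite -[X in se_mul _ X](scale0r (0 : AK)) se_mulZr scale0r. Qed.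
Lemma se_mul_suml (I : finType) (F : I -> AK) v :
  se_mul (\sum_p F p) v = \sum_p se_mul (F p) v.
Proof. by apply: (big_morph (se_mul^~ v)) => [x y|]; rewrite ?se_mulDl ?se_mul0l. Qed.
Lemma se_mul_sumr (I : finType) (F : I -> AK) v :
  se_mul v (\sum_p F p) = \sum_p se_mul v (F p).
Proof. by apply: (big_morph (se_mul v)) => [x y|]; rewrite ?se_mulDr ?se_mul0r. Qed.

Lemma se_inM x y : se_in (x * y) = se_mul (se_in x) (se_in y).
Proof.
rewrite /se_mul {1}[x]basis_sum {1}[y]basis_sum mulr_suml se_in_sum.
apply: eq_bigr => p _; rewrite mulr_sumr se_in_sum; apply: eq_bigr => q _.
by rewrite -scalerAl -scalerAr scalerA se_inZ rmorphM !mxE.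
Qed.

Lemma se_mulA : associative se_mul.
Proof.
have lin u v w : se_mul u (se_mul v w) = \sum_p \sum_q \sum_r
    ((u : 'rV_n) 0 p * ((v : 'rV_n) 0 q * (w : 'rV_n) 0 r)) *:
    se_in (e`_p * (e`_q * e`_r)).
  rewrite {1}[u]se_span se_mul_suml; apply: eq_bigr => p _.
  rewrite [se_mul v w]/se_mul se_mul_sumr; apply: eq_bigr => q _.
  rewrite se_mul_sumr; apply: eq_bigr => r _.
  by rewrite se_mulZl se_mulZr scalerA -se_inM.
have lin' u v w : se_mul (se_mul u v) w = \sum_p \sum_q \sum_r
    ((u : 'rV_n) 0 p * ((v : 'rV_n) 0 q * (w : 'rV_n) 0 r)) *:
    se_in (e`_p * (e`_q * e`_r)).
  rewrite [se_mul u v]/se_mul se_mul_suml; apply: eq_bigr => p _.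
  rewrite se_mul_suml; apply: eq_bigr => q _.
  rewrite {1}[w]se_span se_mul_sumr; apply: eq_bigr => r _.
  by rewrite se_mulZl se_mulZr scalerA -se_inM !mulrA.
by move=> u v w; rewrite lin lin'.
Qed.

Lemma se_mul1 : left_id se_one se_mul.
Proof.
move=> u; rewrite [u in LHS]se_span se_mul_sumr [RHS]se_span.
by apply: eq_bigr => p _; rewrite se_mulZr -se_inM mul1r.
Qed.
Lemma se_mulr1 : right_id se_one se_mul.
Proof.
move=> u; rewrite [u in LHS]se_span se_mul_suml [RHS]se_span.
by apply: eq_bigr => p _; rewrite se_mulZl -se_inM mulr1.
Qed.
Lemma se_one_neq0 : se_one != 0.
Proof.
apply: contraNneq (oner_neq0 A) => /rowP e0; rewrite [1]basis_sum big1 // => p _.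
by have /eqP := e0 p; rewrite !mxE fmorph_eq0 => /eqP->; rewrite scale0r.
Qed.

HB.instance Definition _ := GRing.Zmodule_isNzRing.Build AK
  se_mulA se_mul1 se_mulr1 se_mulDl se_mulDr se_one_neq0.
HB.instance Definition _ := GRing.Lmodule_isLalgebra.Build K AK
  (fun c u v => esym (se_mulZl c u v)).
HB.instance Definition _ := GRing.Lalgebra_isAlgebra.Build K AK
  (fun c u v => esym (se_mulZr c u v)).
HB.instance Definition _ := Algebra_isFalgebra.Build K AK.

End ScalarExt.

(* Elements of Br k are the classes [A] of central simple k-algebras, and     *)
(* Br k -> Br K maps [A] to [A (x)_k K].                                      *)
Definition brauer_injective (k K : fieldType) (i : {rmorphism k -> K}) : Prop :=
  forall A B : falgType k, central_simple A -> central_simple B ->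
    brauer_equiv (scalar_ext i A) (scalar_ext i B) -> brauer_equiv A B.

(* Main.v *)
(* Write C = R(i) and let t be the conjugation of L = C(X) = K(i), K = R(X).  *)
(* Both conditions are equivalent to: -1 is not a sum of two squares in K,    *)
(* i.e. -1 is not a norm w * t w from L.                                      *)
(*   An equivariant retraction r of L^* onto C^* sends w with w * t w = -1 to *)
(* c with |c|^2 = -1, which is absurd. Conversely, if -1 is not a norm, then  *)
(* the norms that are constant are positive reals, so c * (w * t w) |-> c/|c| *)
(* is well defined on the subgroup generated by C^* and the norms. As C^* is  *)
(* divisible it extends to L^*, and its values on the unit circle give the    *)
(* argument of r; the modulus is obtained by symmetrizing any retraction.     *)
(*   By Wedderburn and Frobenius a central simple R-algebra is a matrix       *)
(* algebra over R or over the quaternions H. So the map of Brauer groups is   *)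
(* injective iff H (x) K is not split. It is split when -1 = x^2 + y^2 in K;  *)
(* conversely a splitting gives an element b <> 0 with b A b = K b in a       *)
(* matrix algebra A over H (x) K, hence one in a corner H (x) K, and then the *)
(* norm form of H or the relation i = c gives a sum of two squares.           *)

(* The pivot is the solvability of x^2 + y^2 = -1 in K: [ob_zero_sum2] and [brauer_injective_sum2]
   compare each side of the theorem with it.

   Galois side. By [complex_closure] C is a copy of R[i], so the Galois group consists of the
   identity and conjugation ([gal_conj], [gal_cases]), and L = K(i) by [geom_rect]. Norms from L to
   K are therefore exactly the sums of two squares in K. [coker_split] turns the vanishing of [ob]
   into an equivariant retraction, and [equivariant_retraction] constructs one from modulus and
   argument by means of [divisible_extension].

   Brauer side. [csa_matrix_model] leaves only the two classes of R and H over R, and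
   [quaternion_not_split] separates them. Over K, splitting is detected by a nonzero element b such
   that b x b is a multiple of b for every x ([rank_one]). Having such an element is invariant under
   Brauer equivalence ([rank_one_brauer]), a [rank_one] element stays so under extension of scalars
   ([se_rank_one]), and in a quaternion corner a nonzero one yields a solution ([rank_one_quat]).
   Conversely, a solution gives an explicit 2 by 2 frame of the quaternions ([quaternion_frame]). *)
From HB Require Import structures.
Require Import Defs.
From mathcomp Require Import all_boot all_order all_algebra all_field.
From mathcomp Require Import boolp classical_sets ring lra complex.

Set Implicit Arguments.
Unset Strict Implicit.
Unset Printing Implicit Defensive.
Import GRing.Theory Num.Theory Order.TTheory.
Local Open Scope ring_scope.

(** * Extension of homomorphisms into divisible groups *)

Section DivisibleExtension.
Local Open Scope classical_set_scope.
Variables M D : zmodType.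

(** A homomorphism defined on a subgroup of M is encoded by its graph, so that enlarging it is
    inclusion of sets. The empty set also qualifies, whence the nonemptiness conditions below. *)
Record partial_hom (B : set (M * D)) : Prop := PartialHom {
  partial_hom_sub : forall x d y c, B (x, d) -> B (y, c) -> B (x - y, d - c);
  partial_hom_fun : forall d, B (0, d) -> d = 0
}.

Lemma partial_homMz B x d (n : int) : partial_hom B -> B (x, d) ->
  B (x *~ n, d *~ n).
Proof.
move=> [Bs _] Bx; have B0 : B (0, 0) by have := Bs _ _ _ _ Bx Bx; rewrite !subrr.
have BN y c : B (y, c) -> B (- y, - c).
  by move=> By; have := Bs _ _ _ _ B0 By; rewrite !sub0r.
have Bn m : B (x *+ m, d *+ m).
  elim: m => [|m IHm]; first by rewrite !mulr0n.
  by have := Bs _ _ _ _ Bx (BN _ _ IHm); rewrite !opprK -!mulrS.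
case: n => n; rewrite ?NegzE ?mulrNz; first exact: Bn.
exact/BN/Bn.
Qed.

Hypothesis divD : forall n (d : D), exists d', d' *~ Posz n.+1 = d.

(** The integers m with m x in the domain form an ideal of Z. If it is nonzero, the value at its
    positive generator is divided by that generator; if it is zero, any value of x will do. The
    predicate [p n] speaks of n + 1 to keep the generator positive. *)
Lemma partial_hom_value (B : set (M * D)) x : partial_hom B ->
  exists d', forall (m : int) d, B (x *~ m, d) -> d = d' *~ m.
Proof.
move=> hB; pose p n := `[< exists d, B (x *~ Posz n.+1, d) >].
have [[n pn]|np] := pselect (exists n, p n); last first.
  exists 0 => m d; rewrite mul0rz; case: m => [[|m]|m] Bm.
  - by rewrite mulr0z in Bm; apply: (partial_hom_fun hB).
  - by case: np; exists m; apply/asboolP; exists d.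
  - case: np; exists m; apply/asboolP; exists (- d).
    by have := partial_homMz (- 1) hB Bm; rewrite NegzE -mulrzA mulrNN mulr1 mulrN1z.
have [{pn}n /asboolP[d0 Bn] nmin] := ex_minnP (ex_intro _ n pn).
have [d' d'E] := divD n d0; rewrite -{d0}d'E in Bn.
exists d' => m d Bm; have n0 : Posz n.+1 != 0 by [].
have Br : B (x *~ (m %% n.+1)%Z, d - d' *~ ((m %/ n.+1)%Z * n.+1)).
  have := partial_hom_sub hB Bm (partial_homMz (m %/ n.+1)%Z hB Bn).
  by rewrite -!mulrzA ![_ * (m %/ _)%Z]mulrC -mulrzBr {1}[m](divz_eq _ n.+1) addrC addKr.
have := modz_ge0 m n0; have := ltz_mod m n0; rewrite [X in d' *~ X](divz_eq _ n.+1).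
case: (m %% n.+1)%Z Br => [[|r]|//] Br /= rn _.
  rewrite addr0; apply/eqP; rewrite -subr_eq0; apply/eqP.
  by apply: (partial_hom_fun hB); rewrite mulr0z in Br.
have : (n <= r)%N by apply: nmin; apply/asboolP; eexists; apply: Br.
by rewrite leqNgt => /negP[].
Qed.

Lemma divisible_extension (B : set (M * D)) : partial_hom B -> B !=set0 ->
  exists2 f : M -> D, zmod_morphism f & forall x d, B (x, d) -> f x = d.
Proof.
move=> hB B0.
(* The empty set must satisfy [P], because it is the union of the empty chain; it is not maximal,
   since B lies above it. *)
pose P X := X !=set0 -> B `<=` X /\ partial_hom X.
have [F PF Fc|A [PA Amax]] := @Zorn_bigcup _ P.
  move=> [p0 [X FX Xp]]; have [BX _] := PF _ FX (ex_intro _ _ Xp).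
  split=> [p Bp|]; first by exists X => //; apply: BX.
  split=> [x d y c [Y FY Yx] [Z FZ Zy]|d [Y FY Yd]]; last first.
    by have [_ hY] := PF _ FY (ex_intro _ _ Yd); apply: (partial_hom_fun hY).
  have [_ hY] := PF _ FY (ex_intro _ _ Yx); have [_ hZ] := PF _ FZ (ex_intro _ _ Zy).
  have [YZ|ZY] := Fc _ _ FY FZ.
    by exists Z => //; apply: (partial_hom_sub hZ) => //; apply: YZ.
  by exists Y => //; apply: (partial_hom_sub hY) => //; apply: ZY.
have A0 : A !=set0.
  apply: contrapT => A0; apply: (Amax B); last by move=> _; split.
  split=> [p Ap|BA]; first by case: A0; exists p.
  by case: B0 => p Bp; apply: A0; exists p; apply: BA.
have [BA hA] := PA A0; have [As Af] := hA.
have A00 : A (0, 0) by case: A0 => [[x d] Ax]; have := As _ _ _ _ Ax Ax; rewrite !subrr.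
have At x : exists d, A (x, d).
  have [d' d'P] := partial_hom_value x hA.
  (* A' is the subgroup generated by A and (x, d'); the choice of d' keeps it the graph of a
     function. *)
  pose A' : set (M * D) := fun p => exists m : int, A (p.1 - x *~ m, p.2 - d' *~ m).
  have AA' : A `<=` A' by move=> [y c] Ay; exists 0; rewrite !mulr0z !subr0.
  exists d'; apply: contrapT => Ax; apply: (Amax A').
    split=> // A'A; apply/Ax/A'A; exists 1.
    by rewrite !mulr1z !subrr.
  move=> _; split; first exact: subset_trans BA AA'.
  split=> [y d z c [m Am] [n An]|d [m /= Am]].
    exists (m - n) => /=; have := As _ _ _ _ Am An.
    have e (V : zmodType) (a b a' b' : V) : a - b - (a' - b') = a - a' - (b - b').
      by rewrite !opprD addrACA.
    by rewrite (e _ y) (e _ d) -!mulrzBr.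
  rewrite sub0r -mulrNz in Am; have := d'P _ _ Am.
  by move/eqP; rewrite mulrNz subr_eq addNr => /eqP.
pose f x := projT1 (cid (At x)); have fP x : A (x, f x) by rewrite /f; case: cid.
have fE x d : A (x, d) -> f x = d.
  move=> Ax; apply/eqP; rewrite -subr_eq0; apply/eqP/Af.
  by rewrite -[0](subrr x); apply: As.
exists f => [x y|x d Bx]; first exact/fE/As.
exact/fE/BA.
Qed.

End DivisibleExtension.

(** * Matrix frames in central simple algebras *)

Definition corner (R : pzRingType) (e x : R) := e * x = x /\ x * e = x.

Lemma corner_mul (R : pzRingType) (e x y : R) :
  corner e x -> corner e y -> corner e (x * y).
Proof. by move=> [ex xe] [ey ye]; split; rewrite ?mulrA ?ex // -mulrA ye. Qed.

Lemma corner_sandwich (R : pzRingType) (e x : R) :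
  corner e e -> corner e (e * x * e).
Proof. by move=> [ee _]; split; [rewrite !mulrA ee | rewrite -[LHS]mulrA ee]. Qed.

Record division_idem (R : pzRingType) (e : R) : Prop := DivisionIdem {
  didem_neq0 : e != 0;
  didem_id : corner e e;
  didem_inv : forall x, corner e x -> x != 0 ->
    exists y, [/\ corner e y, x * y = e & y * x = e]
}.

(* A is isomorphic to the matrix ring over its corner eAe, the entries of a   *)
(* being v_i * a * w_j.                                                       *)
Record matrix_frame (R : pzRingType) (e : R) n (v w : 'I_n -> R) : Prop :=
  MatrixFrame {
    frame_id : corner e e;
    frame_l : forall i, e * v i = v i;
    frame_r : forall i, w i * e = w i;
    frame_dual : forall i j, v i * w j = if i == j then e else 0;
    frame_sum : \sum_i w i * v i = 1
  }.

Section SimpleAlgebra.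
Variables (k : fieldType) (A : falgType k).
Hypothesis csA : central_simple A.
Implicit Types x y z a b : A.

(** The z with x A z = 0 form a two-sided ideal. By simplicity it is zero or contains 1, and in the
    second case x = 0. *)
Lemma csa_prime x y : x != 0 -> y != 0 -> exists a, x * a * y != 0.
Proof.
move=> x0 y0; apply: contrapT => /forallNP xy.
(* Testing x a z = 0 for a in a basis presents this ideal as a finite intersection of kernels, hence
   as a subspace. *)
pose I : {vspace A} :=
  (\bigcap_(i < \dim {:A}) lker (amull (x * (vbasis {:A})`_i)%R))%VS.
have IP z : reflect (forall a, x * a * z = 0) (z \in I).
  apply: (iffP idP) => [zI a|z0]; last first.
    rewrite memvE; apply/subv_bigcapP => i _.
    by rewrite -memvE memv_ker lfunE /= z0.
  rewrite [a](basis_sum a) mulr_sumr mulr_suml big1 // => i _.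
  rewrite -scalerAr -scalerAl; move: zI; rewrite memvE => /subv_bigcapP/(_ i isT).
  by rewrite -memvE memv_ker lfunE /= => /eqP->; rewrite scaler0.
have [] := csA.2 I.
- move=> a z /IP z0; split; apply/IP => b; first by rewrite mulrA -(mulrA x) z0.
  by rewrite mulrA z0 mul0r.
- move=> I0; move: y0; have : y \in I by apply/IP => a; apply/eqP/negPn/negP.
  by rewrite I0 memv0 => ->.
- move=> If; have /IP/(_ 1) : (1 : A) \in I by rewrite If memvf.
  by rewrite !mulr1; apply/eqP.
Qed.

(* Brauer's lemma: a minimal right ideal xA is generated by an idempotent.    *)
Lemma exists_division_idem : exists e : A, division_idem e.
Proof.
pose p n := `[< exists2 x : A, x != 0 & \dim (limg (amull x)) = n >].
have p1 : exists n, p n.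
  by eexists; apply/asboolP; exists (1 : A); [exact: oner_neq0 | reflexivity].
have [{p1}_ /asboolP[x x0 <-] xmin] := ex_minnP p1.
(* By minimality of the dimension, every nonzero z in xA generates all of xA. *)
have gen (z : A) : z != 0 -> (exists a, z = x * a) -> exists b, x = z * b.
  move=> z0 [a za]; have : x \in limg (amull x).
    by apply/memv_imgP; exists 1; rewrite ?memvf // lfunE /= mulr1.
  suff <- : limg (amull z) = limg (amull x).
    by case/memv_imgP=> b _; rewrite lfunE /=; exists b.
  apply/eqP; rewrite eqEdim xmin ?andbT; last by apply/asboolP; exists z.
  apply/subvP => _ /memv_imgP[b _ ->]; rewrite lfunE /= za.
  by apply/memv_imgP; exists (a * b); rewrite ?memvf // lfunE /= mulrA.
(* From x a x != 0 comes b with x = x a x b. For y = x a and e = x b a this gives y e = y, so y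
   annihilates e e - e on the left, whereas y x != 0. *)
have [a xax] := csa_prime x0 x0.
have [||b xb] := gen (x * a * x) => //; first by exists (a * x); rewrite mulrA.
have [y yE] : exists y, y = x * a by exists (x * a).
have [e eE] : exists e, e = x * (b * a) by exists (x * (b * a)).
have ye : y * e = y by rewrite yE eE !mulrA -xb.
have y0 : y != 0 by apply: contraNneq xax; rewrite -yE => ->; rewrite mul0r.
have e0 : e != 0 by apply: contraNneq y0 => e0; rewrite -ye e0 mulr0.
have ee : e * e = e.
  apply/eqP; rewrite -subr_eq0; apply/negPn/negP => ee0; have [|c xc] := gen _ ee0.
    by exists (b * a * e - b * a); rewrite mulrBr [in RHS]mulrA -eE.
  by move/eqP: xax; rewrite -yE xc mulrA mulrBr mulrA !ye subrr mul0r.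
(* Since z lies in xA, x = z c for some c, and e = x b a is a right multiple of z. A right inverse
   that itself has a right inverse is two-sided. *)
have rinv z : corner e z -> z != 0 -> exists u, corner e u /\ z * u = e.
  move=> [ez ze] z0; have [] := gen z z0; first by exists (b * a * z); rewrite mulrA -eE.
  move=> c xc; exists (e * (c * (b * a)) * e); split.
    by split; [rewrite !mulrA ee | rewrite -[LHS]mulrA ee].
  by rewrite !mulrA ze -xc -(mulrA x b) -eE ee.
exists e; split=> // z ez z0; have [u [eu zu]] := rinv z ez z0.
have u0 : u != 0 by apply: contraNneq e0 => u0; rewrite -zu u0 mulr0.
have [t [et ut]] := rinv u eu u0; exists u; split=> //.
suff <- : t = z by [].
by rewrite -(proj1 et) -zu -mulrA ut (proj2 ez).
Qed.

Variable e : A.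
Hypothesis eD : division_idem e.

Record partial_frame n (v w : 'I_n -> A) : Prop := PartialFrame {
  pframe_l : forall i, e * v i = v i;
  pframe_r : forall i, w i * e = w i;
  pframe_dual : forall i j, v i * w j = if i == j then e else 0
}.

Lemma partial_frame_bound n (v w : 'I_n -> A) : partial_frame v w -> (n <= \dim {:A})%N.
Proof.
move=> [_ _ vw].
suff fv : free [tuple v i | i < n].
  move: fv; rewrite /free size_tuple => /eqP <-; exact/dimvS/subvf.
apply/freeP => c c0 i; have := congr1 (fun x => x * w i) c0.
rewrite mulr_suml mul0r (bigD1 i) //= big1 => [|j ji].
  by rewrite nth_mktuple -scalerAl vw eqxx addr0 => /eqP;
    rewrite scaler_eq0 (negPf (didem_neq0 eD)) orbF => /eqP.
by rewrite nth_mktuple -scalerAl vw (negPf ji) scaler0.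
Qed.

(** The defect f is a nonzero idempotent orthogonal to the frame. Primeness gives e a f b e != 0,
    which has an inverse d in the division ring eAe; the pair e a f, f b e d is then added at index
    0. *)
Lemma partial_frame_extend n (v w : 'I_n -> A) : partial_frame v w ->
  \sum_i w i * v i != 1 -> exists v' w' : 'I_n.+1 -> A, partial_frame v' w'.
Proof.
move=> [ev we vw]; rewrite eq_sym -subr_eq0; set f := 1 - _ => f0.
have vf i : v i * f = 0.
  rewrite mulrBr mulr1 mulr_sumr (bigD1 i) //= big1 => [|j ji].
    by rewrite mulrA vw eqxx ev addr0 subrr.
  by rewrite mulrA vw eq_sym (negPf ji) mul0r.
have fw i : f * w i = 0.
  rewrite mulrBl mul1r mulr_suml (bigD1 i) //= big1 => [|j ji].
    by rewrite -mulrA vw eqxx we addr0 subrr.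
  by rewrite -mulrA vw (negPf ji) mulr0.
have ff : f * f = f.
  rewrite {2}/f mulrBr mulr1 mulr_sumr big1 ?subr0 // => i _.
  by rewrite mulrA fw mul0r.
have [e0 [ee _] einv] := eD.
have [a eaf] := csa_prime e0 f0; have [b vbe] := csa_prime eaf e0.
have [||d [[ed de] vd _]] := einv (e * a * f * b * e) => //.
  by split; [rewrite !mulrA ee | rewrite -[LHS]mulrA ee].
exists (fun i => oapp v (e * a * f) (unlift ord0 i)).
exists (fun i => oapp w (f * b * e * d) (unlift ord0 i)).
split=> [i|i|i j].
- by case: unliftP => [i' _|_] /=; rewrite ?ev // !mulrA ee.
- by case: unliftP => [i' _|_] /=; rewrite ?we // -!mulrA de.
case: (unliftP ord0 i) => [i' ->|->]; case: (unliftP ord0 j) => [j' ->|->] /=.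
- by rewrite (inj_eq lift_inj) vw.
- by rewrite !mulrA vf !mul0r.
- by rewrite -mulrA fw mulr0.
- by rewrite ?eqxx !mulrA -(mulrA (e * a)) ff vd.
Qed.

Lemma exists_matrix_frame : exists n (v w : 'I_n.+1 -> A), matrix_frame e v w.
Proof.
pose p n := `[< exists v w : 'I_n -> A, partial_frame v w >].
have p0 : exists n, p n.
  by exists 0; apply/asboolP; exists (fun=> 0), (fun=> 0); split=> [[]|[]|[]].
have pb n : p n -> (n <= \dim {:A})%N.
  by move=> /asboolP[v [w]]; apply: partial_frame_bound.
have [n /asboolP[v [w vw]] nmax] := ex_maxnP p0 pb.
have vw1 : \sum_i w i * v i = 1.
  apply/eqP/negPn/negP => /(partial_frame_extend vw) vw'.
  by have := nmax n.+1; rewrite ltnn => /(_ (asboolT vw')).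
case: n v w vw vw1 {nmax} => [|n] v w [ev we d] vw1.
  by move/eqP: vw1; rewrite big_ord0 eq_sym oner_eq0.
by exists n, v, w; split=> //; apply: didem_id eD.
Qed.

(** Repeating z along the diagonal of the matrix ring over eAe gives t, which is central in A and
    hence a scalar; z is a diagonal entry of t. *)
Lemma corner_center z : corner e z ->
  (forall x, corner e x -> x * z = z * x) -> exists c : k, z = c *: e.
Proof.
move=> [ez ze] zC; have [n [v [w [[ee _] ev we d vw1]]]] := exists_matrix_frame.
have cvw a i j : corner e (v i * a * w j).
  by split; [rewrite !mulrA ev | rewrite -[LHS]mulrA we].
pose t := \sum_i w i * z * v i.
have [|c tc] := csA.1 t.
  move=> a; rewrite -[LHS]mulr1 -[RHS]mul1r -vw1 /t.
  rewrite !mulr_suml; apply: eq_bigr => i _; rewrite !mulr_sumr; apply: eq_bigr => j _.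
  have -> : w i * z * v i * a * (w j * v j) = w i * (z * (v i * a * w j)) * v j.
    by rewrite !mulrA.
  by rewrite -zC // !mulrA.
exists c; have tz : v ord0 * t * w ord0 = z.
  rewrite mulr_sumr mulr_suml (bigD1 ord0) //= big1 => [|i i0].
    by rewrite !mulrA d eqxx ez -mulrA d eqxx ze addr0.
  by rewrite !mulrA d eq_sym (negPf i0) !mul0r.
by rewrite -tz tc -scalerAr -scalerAl mulr1 d eqxx.
Qed.

End SimpleAlgebra.

(** * Matrix algebras and Brauer equivalence *)

Section Morita.
Variable k : fieldType.
Implicit Types T A B : falgType k.

(* A is isomorphic to a matrix algebra over T.                                *)
Definition matrix_model T A : Prop :=
  exists n (v w : 'I_n.+1 -> A) (Q : {linear T -> A}),
    [/\ matrix_frame (Q 1) v w, {morph Q : x y / x * y}, injective Q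
      & forall x, corner (Q 1) x -> exists t, Q t = x].

Lemma frame_mid A e n (v w : 'I_n -> A) (x y : A) : matrix_frame e v w ->
  \sum_i x * w i * (v i * y) = x * y.
Proof.
move=> vw; rewrite -{2}[x]mulr1 -(frame_sum vw) mulr_sumr mulr_suml.
by apply: eq_bigr => i _; rewrite !mulrA.
Qed.

Lemma frame_corner A e n (v w : 'I_n -> A) x i j : matrix_frame e v w ->
  corner e (v i * x * w j).
Proof.
move=> vw; split; first by rewrite !mulrA (frame_l vw).
by rewrite -[LHS]mulrA (frame_r vw).
Qed.

Lemma frame_diag A e n (v w : 'I_n -> A) : matrix_frame e v w ->
  forall F : 'I_n -> 'I_n -> A, (forall i j, corner e (F i j)) ->
  forall i j, v i * (\sum_p \sum_q w p * F p q * v q) * w j = F i j.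
Proof.
move=> vw F FP i j; rewrite mulr_sumr mulr_suml (bigD1 i) //= [X in _ + X]big1.
  rewrite addr0 mulr_sumr mulr_suml (bigD1 j) //= [X in _ + X]big1.
    by rewrite !mulrA (frame_dual vw) eqxx -mulrA (frame_dual vw) eqxx addr0
               (proj1 (FP i j)) (proj2 (FP i j)).
  by move=> q qj; rewrite -!mulrA (frame_dual vw) (negPf qj) !mulr0.
move=> p pi; rewrite mulr_sumr mulr_suml big1 // => q _.
by rewrite !mulrA (frame_dual vw) eq_sym (negPf pi) !mul0r.
Qed.

Lemma frame_expand A e n (v w : 'I_n -> A) (x : A) : matrix_frame e v w ->
  \sum_p \sum_q w p * (v p * x * w q) * v q = x.
Proof.
move=> vw; rewrite -[RHS]mulr1 -(frame_sum vw) mulr_sumr exchange_big.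
apply: eq_bigr => q _ /=; rewrite -[in RHS](mul1r x) -(frame_sum vw) !mulr_suml.
by apply: eq_bigr => p _; rewrite !mulrA.
Qed.

Lemma frame_ext A e n (v w : 'I_n -> A) (x y : A) : matrix_frame e v w ->
  (forall i j, v i * x * w j = v i * y * w j) -> x = y.
Proof.
move=> vw xy; rewrite -(frame_expand x vw) -(frame_expand y vw).
by apply: eq_bigr => i _; apply: eq_bigr => j _; rewrite xy.
Qed.

(** With A = M_{n+1}(T) and B = M_{m+1}(T), both M_{m+1}(A) and M_{n+1}(B) are matrices over T with
    two pairs of indices; the isomorphism [F] exchanges inner and outer indices. *)
Lemma matrix_model_brauer T A B :
  matrix_model T A -> matrix_model T B -> brauer_equiv A B.
Proof.
move=> [n [v [w [Q [vw QM Qi Qs]]]]] [m [v' [w' [Q' [vw' QM' Qi' Qs']]]]].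
have cQ (S : falgType k) (P : {linear T -> S}) : {morph P : x y / x * y} ->
    forall t, corner (P 1) (P t).
  by move=> PM t; split; rewrite -PM ?mul1r ?mulr1.
have inv (S : falgType k) (P : {linear T -> S}) : injective P ->
    exists q : S -> T, forall t, q (P t) = t.
  move=> Pi; pose q x := if pselect (exists t, P t = x) is left e then projT1 (cid e) else 0.
  exists q => t; rewrite /q; case: pselect => [e|[]]; last by exists t.
  by apply: Pi; case: cid.
have [q qQ] := inv _ _ Qi; have [q' qQ'] := inv _ _ Qi'.
have Qq i j a : Q (q (v i * a * w j)) = v i * a * w j.
  by have [t <-] := Qs _ (frame_corner a i j vw); rewrite qQ.
have Qq' i j a : Q' (q' (v' i * a * w' j)) = v' i * a * w' j.
  by have [t <-] := Qs' _ (frame_corner a i j vw'); rewrite qQ'.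
pose F (X : 'M[A]_m.+1) : 'M[B]_n.+1 := \matrix_(i, j)
  \sum_p \sum_r w' p * Q' (q (v i * X p r * w j)) * v' r.
pose G (Y : 'M[B]_n.+1) : 'M[A]_m.+1 := \matrix_(p, r)
  \sum_i \sum_j w i * Q (q' (v' p * Y i j * w' r)) * v j.
have FE X i j p r : v' p * F X i j * w' r = Q' (q (v i * X p r * w j)).
  by rewrite mxE (frame_diag vw') // => p' r'; apply: cQ.
have GE Y p r i j : v i * G Y p r * w j = Q (q' (v' p * Y i j * w' r)).
  by rewrite mxE (frame_diag vw) // => i' j'; apply: cQ.
have FB : zmod_morphism F.
  move=> X Y; apply/matrixP => i j; apply: (frame_ext vw') => p r.
  have -> : (F X - F Y) i j = F X i j - F Y i j by rewrite !mxE.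
  rewrite mulrBr mulrBl !FE -linearB; congr (Q' _).
  by rewrite -[RHS]qQ linearB /= !Qq !mxE mulrBr mulrBl.
have FM : monoid_morphism F.
  split=> [|X Y]; apply/matrixP => i j; apply: (frame_ext vw') => p r; rewrite FE.
    rewrite !mxE !mulr_natr !mulrnAl (frame_dual vw) (frame_dual vw').
    case: (p == r); case: (i == j); rewrite ?mulr1n ?mulr0n ?qQ //;
      by rewrite -(linear0 Q) qQ linear0.
  rewrite !mxE.
  have -> : v i * (\sum_t X p t * Y t r) * w j = Q (\sum_l \sum_t
      q (v i * X p t * w l) * q (v l * Y t r * w j)).
    rewrite exchange_big linear_sum mulr_sumr mulr_suml; apply: eq_bigr => t _ /=.
    rewrite mulrA -(mulrA (v i * X p t)) -(frame_mid _ _ vw) linear_sum.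
    by apply: eq_bigr => l _; rewrite QM !Qq !mulrA.
  rewrite qQ linear_sum mulr_sumr mulr_suml; apply: eq_bigr => l _ /=.
  rewrite mulrA -(mulrA (v' p * F X i l)) -(frame_mid _ _ vw') linear_sum.
  by apply: eq_bigr => t _; rewrite QM' -!FE !mulrA.
have FZ (c : k) X : F (map_mx ( *:%R c) X) = map_mx ( *:%R c) (F X).
  apply/matrixP => i j; apply: (frame_ext vw') => p r.
  rewrite FE [in RHS]mxE -scalerAr -scalerAl FE -linearZ; congr (Q' _).
  by rewrite -[RHS]qQ linearZ /= !Qq !mxE -scalerAr -scalerAl.
pose f : {rmorphism 'M[A]_m.+1 -> 'M[B]_n.+1} := HB.pack F
  (GRing.isZmodMorphism.Build _ _ F FB) (GRing.isMonoidMorphism.Build _ _ F FM).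
exists m, n, f; split=> //; exists G => X; apply/matrixP => i j.
  by apply: (frame_ext vw) => i' j'; rewrite GE -[f X]/(F X) FE qQ' Qq.
by apply: (frame_ext vw') => i' j'; rewrite -[f _]/(F _) FE GE qQ Qq'.
Qed.

Lemma split_matrix_model A e n (v w : 'I_n.+1 -> A) : matrix_frame e v w ->
  (forall x, corner e x -> exists t : k, x = t *: e) -> matrix_model (k^o : falgType k) A.
Proof.
move=> vw eS; pose Q (t : k^o) : A := t *: e.
have e0 : e != 0.
  apply: contraNneq (oner_neq0 A) => e0; rewrite -(frame_sum vw) big1 // => i _.
  by rewrite -(frame_l vw) e0 mul0r mulr0.
have Ql : linear Q by move=> a x y; rewrite /Q scalerDl scalerA.
pose QL : {linear k^o -> A} := HB.pack Q (GRing.isLinear.Build k k^o A *:%R Q Ql).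
exists n, v, w, QL; rewrite [QL 1]/(Q 1) /Q scale1r; split=> //.
- by move=> x y; rewrite /= /Q -scalerAl -scalerAr scalerA (proj1 (frame_id vw)).
- by apply: raddf_inj => t /eqP; rewrite scaler_eq0 (negPf e0) orbF => /eqP.
by move=> x /eS[t ->]; exists t.
Qed.

Lemma brauer_equiv_sym A B : brauer_equiv A B -> brauer_equiv B A.
Proof.
move=> [m [n [f [fb fZ]]]]; have [g fK gK] := fb; have gi := can_inj gK.
have fi := can_inj fK.
have gB : zmod_morphism g by move=> X Y; apply: fi; rewrite rmorphB !gK.
have gM : monoid_morphism g.
  by split=> [|X Y]; apply: fi; rewrite ?rmorph1 ?rmorphM !gK.
pose h : {rmorphism 'M[B]_n.+1 -> 'M[A]_m.+1} := HB.pack g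
  (GRing.isZmodMorphism.Build _ _ g gB) (GRing.isMonoidMorphism.Build _ _ g gM).
exists n, m, h; split; first by exists f.
by move=> c X; apply: fi; rewrite fZ !gK.
Qed.

(* The case b = 0 is allowed, so that multiples of b keep the property.       *)
Definition rank_one A (b : A) : Prop := forall x, exists c : k, b * x * b = c *: b.

Lemma rank_one_mul A (b x y : A) : rank_one b -> rank_one (x * b * y).
Proof.
move=> b1 z; have [c bc] := b1 (y * z * x); exists c.
by rewrite scalerAl scalerAr -bc !mulrA.
Qed.

(** The matrix M with the single entry a has the same property in the matrix ring, and so has its
    image under the isomorphism; any nonzero entry of that image inherits it. *)
Lemma rank_one_brauer A B : brauer_equiv A B ->
  (exists2 a : A, a != 0 & rank_one a) -> exists2 b : B, b != 0 & rank_one b.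
Proof.
move=> [m [n [f [fb fZ]]]] [a a0 a1].
have [g fK gK] := fb; have fi := can_inj fK.
pose M : 'M[A]_m.+1 := \matrix_(i, j) if (i == 0) && (j == 0) then a else 0.
have M1 X : exists c : k, M * X * M = map_mx ( *:%R c) M.
  have [c ac] := a1 (X 0 0); exists c; apply/matrixP => i j; rewrite !mxE.
  have MX l : (M * X) i l = if i == 0 then a * X 0 l else 0.
    rewrite mxE (bigD1 0) //= big1 ?addr0 => [|p p0].
      by rewrite !mxE eqxx andbT; case: (i == 0); rewrite ?mul0r.
    by rewrite mxE (negPf p0) andbF mul0r.
  rewrite (bigD1 0) //= big1 ?addr0 => [|p p0].
    rewrite MX !mxE eqxx /=; case: (i == 0); case: (j == 0) => //=.
    - by rewrite mulr0 scaler0.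
    - by rewrite mul0r scaler0.
    - by rewrite mul0r scaler0.
  by rewrite [M p j]mxE (negPf p0) mulr0.
have fM0 : f M != 0.
  apply: contraNneq a0; rewrite -(rmorph0 f) => /fi/matrixP/(_ 0 0).
  by rewrite !mxE /= => ->.
have [i [j fij]] : exists i j, f M i j != 0.
  apply: contrapT => f0; move/eqP: fM0; apply; apply/matrixP => i j.
  rewrite [RHS]mxE; apply/eqP/negPn/negP => fij.
  by apply: f0; exists i, j.
exists (f M i j) => // x.
(* With x placed at (j, i), the (i, j) entry of f M * Y * f M is f M i j * x * f M i j. *)
pose Y : 'M[B]_n.+1 := \matrix_(p, q) if (p == j) && (q == i) then x else 0.
have [c Mc] := M1 (g Y); exists c.
have e : f M * Y * f M = map_mx ( *:%R c) (f M) by rewrite -fZ -Mc !rmorphM /= gK.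
have -> : c *: f M i j = (f M * Y * f M) i j by rewrite e mxE.
rewrite mxE (bigD1 i) //= big1 ?addr0 => [|p pi].
  congr (_ * _); rewrite mxE (bigD1 j) //= big1 ?addr0 => [|p pj].
    by rewrite mxE !eqxx.
  by rewrite [Y p i]mxE (negPf pj) mulr0.
rewrite [(f M * Y) i p]mxE big1 ?mul0r // => q _.
by rewrite [Y q p]mxE (negPf pi) andbF mulr0.
Qed.

End Morita.

(** * Quaternions *)

Definition quaternion (k : fieldType) : Type := (k^o * k^o * (k^o * k^o))%type.

Section Quaternion.
Variable k : fieldType.
Local Notation H := (quaternion k).

HB.instance Definition _ := Vector.copy H (k^o * k^o * (k^o * k^o))%type.

Definition quat (a b c d : k) : H := ((a, b), (c, d)).
Definition qmul (p q : H) : H :=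
  let: ((a, b), (c, d)) := p in let: ((a', b'), (c', d')) := q in
  quat (a * a' - b * b' - c * c' - d * d') (a * b' + b * a' + c * d' - d * c')
       (a * c' - b * d' + c * a' + d * b') (a * d' + b * c' - c * b' + d * a').

Lemma qaddE a b c d a' b' c' d' :
  quat a b c d + quat a' b' c' d' = quat (a + a') (b + b') (c + c') (d + d').
Proof. by []. Qed.
Lemma qscaleE x a b c d : x *: quat a b c d = quat (x * a) (x * b) (x * c) (x * d).
Proof. by []. Qed.
Lemma qmulE a b c d a' b' c' d' : qmul (quat a b c d) (quat a' b' c' d') =
  quat (a * a' - b * b' - c * c' - d * d') (a * b' + b * a' + c * d' - d * c')
       (a * c' - b * d' + c * a' + d * b') (a * d' + b * c' - c * b' + d * a').
Proof. by []. Qed.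

Lemma quat_ind (P : H -> Prop) : (forall a b c d, P (quat a b c d)) -> forall q, P q.
Proof. by move=> Pq [[a b] [c d]]; apply: Pq. Qed.

Lemma qmulA : associative qmul.
Proof.
elim/quat_ind=> ????; elim/quat_ind=> ????; elim/quat_ind=> ????; rewrite !qmulE.
by congr quat; ring.
Qed.
Lemma qmul1 : left_id (quat 1 0 0 0) qmul.
Proof. by elim/quat_ind=> ????; rewrite qmulE; congr quat; ring. Qed.
Lemma qmulr1 : right_id (quat 1 0 0 0) qmul.
Proof. by elim/quat_ind=> ????; rewrite qmulE; congr quat; ring. Qed.
Lemma qmulDl : left_distributive qmul +%R.
Proof.
elim/quat_ind=> ????; elim/quat_ind=> ????; elim/quat_ind=> ????.
by rewrite !(qmulE, qaddE); congr quat; ring.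
Qed.
Lemma qmulDr : right_distributive qmul +%R.
Proof.
elim/quat_ind=> ????; elim/quat_ind=> ????; elim/quat_ind=> ????.
by rewrite !(qmulE, qaddE); congr quat; ring.
Qed.
Lemma qone_neq0 : quat 1 0 0 0 != 0.
Proof. by apply/eqP => -[] /eqP; rewrite oner_eq0. Qed.

Lemma qscaleAl x (p q : H) : x *: qmul p q = qmul (x *: p) q.
Proof.
move: p q; elim/quat_ind=> ????; elim/quat_ind=> ????.
by rewrite !(qmulE, qscaleE); congr quat; ring.
Qed.
Lemma qscaleAr x (p q : H) : x *: qmul p q = qmul p (x *: q).
Proof.
move: p q; elim/quat_ind=> ????; elim/quat_ind=> ????.
by rewrite !(qmulE, qscaleE); congr quat; ring.
Qed.
HB.instance Definition _ := GRing.Zmodule_isNzRing.Build H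
  qmulA qmul1 qmulr1 qmulDl qmulDr qone_neq0.

HB.instance Definition _ := GRing.Lmodule_isLalgebra.Build k H qscaleAl.
HB.instance Definition _ := GRing.Lalgebra_isAlgebra.Build k H qscaleAr.
HB.instance Definition _ := Algebra_isFalgebra.Build k H.

Lemma hmulE a b c d a' b' c' d' : (quat a b c d : H) * (quat a' b' c' d' : H) =
  quat (a * a' - b * b' - c * c' - d * d') (a * b' + b * a' + c * d' - d * c')
       (a * c' - b * d' + c * a' + d * b') (a * d' + b * c' - c * b' + d * a').
Proof. by []. Qed.

Definition qconj (q : H) : H := let: ((a, b), (c, d)) := q in quat a (- b) (- c) (- d).
Definition qnorm (q : H) : k :=
  let: ((a, b), (c, d)) := q in a ^+ 2 + b ^+ 2 + (c ^+ 2 + d ^+ 2).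

Lemma hmul_conj q : q * qconj q = qnorm q *: 1.
Proof.
elim/quat_ind: q => a b c d; rewrite [LHS]hmulE -[RHS]/(_ *: quat 1 0 0 0) qscaleE.
by congr quat; rewrite /=; ring.
Qed.

(** If both pairs of squares have sum zero, a nonzero pair shows that -1 is a square. Otherwise -1
    is a quotient of two sums of two squares, hence again such a sum. *)
Lemma qnorm0_sum2 q : q != 0 -> qnorm q = 0 -> exists x y : k, x ^+ 2 + y ^+ 2 = -1.
Proof.
have sum2 (a b : k) : a != 0 -> a ^+ 2 + b ^+ 2 = 0 -> exists x y : k, x ^+ 2 + y ^+ 2 = -1.
  move=> a0 /eqP; rewrite addrC addr_eq0 => /eqP ab; exists (b / a), 0.
  by rewrite expr_div_n ab mulNr divff ?expf_neq0 // expr0n addr0.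
have sum2' (a b : k) : (a, b) != 0 -> a ^+ 2 + b ^+ 2 = 0 ->
    exists x y : k, x ^+ 2 + y ^+ 2 = -1.
  have [->|a0] := eqVneq a 0; last by move=> _; apply: sum2.
  have [->|b0 _] := eqVneq b 0; first by move/eqP.
  by rewrite addrC; apply: sum2.
elim/quat_ind: q => a b c d q0 /= N0.
have [s0|s0] := eqVneq (c ^+ 2 + d ^+ 2) 0.
  have [cd|] := eqVneq ((c, d) : k^o * k^o) 0; last by move/sum2'; apply.
  apply: (@sum2' a b); last by rewrite s0 addr0 in N0.
  by apply: contraNneq q0 => ab; rewrite /quat cd ab.
(* (a c + b d)^2 + (a d - b c)^2 = (a^2 + b^2) (c^2 + d^2) *)
exists ((a * c + b * d) / (c ^+ 2 + d ^+ 2)), ((a * d - b * c) / (c ^+ 2 + d ^+ 2)).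
transitivity ((a ^+ 2 + b ^+ 2) / (c ^+ 2 + d ^+ 2)); first by field.
by move/eqP: N0; rewrite addr_eq0 => /eqP ->; rewrite mulNr divff.
Qed.

End Quaternion.

(** * Images of the quaternions in a corner *)

Section QuaternionTriple.
Variables (k : fieldType) (A : falgType k).
Implicit Types e I J x : A.

Record quat_triple e I J : Prop := QuatTriple {
  qt_id : corner e e;
  qt_I : corner e I;
  qt_J : corner e J;
  qt_II : I * I = - e;
  qt_JJ : J * J = - e;
  qt_JI : J * I = - (I * J)
}.

Definition qmap e I J (q : quaternion k) : A :=
  let: ((a, b), (c, d)) := q in a *: e + b *: I + (c *: J + d *: (I * J)).

Lemma qmap_is_linear e I J : linear (qmap e I J).
Proof.
move=> x; elim/quat_ind=> a b c d; elim/quat_ind=> a' b' c' d'.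
rewrite qscaleE qaddE /= !scalerDr !scalerA !scalerDl.
rewrite [RHS]addrACA; congr (_ + _); first by rewrite addrACA.
by rewrite addrACA.
Qed.
HB.instance Definition _ e I J :=
  GRing.isLinear.Build k (quaternion k) A *:%R (qmap e I J) (qmap_is_linear e I J).

Lemma qmapZ e I J (t : k) q : qmap e I J (t *: q) = t *: qmap e I J q.
Proof. exact: linearZ. Qed.

Lemma qmap1 e I J : qmap e I J 1 = e.
Proof. by rewrite /= !scale0r scale1r !addr0. Qed.

Variables (e I J : A).
Hypothesis eIJ : quat_triple e I J.

Lemma qmapI a b c d : I * qmap e I J (quat a b c d) = qmap e I J (quat (- b) a (- d) c).
Proof.
have [_ [_ Ie] _ II _ _] := eIJ.
rewrite /= !mulrDr -!scalerAr mulrA Ie II mulNr (proj1 (qt_J eIJ)) !scalerN !scaleNr.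
by rewrite [a *: I + _]addrC [c *: (I * J) + _]addrC.
Qed.
Lemma qmapJ a b c d : J * qmap e I J (quat a b c d) = qmap e I J (quat (- c) d a (- b)).
Proof.
have [_ [_ Ie] [_ Je] II JJ JI] := eIJ.
rewrite /= !mulrDr -!scalerAr mulrA JI Je JJ mulNr -mulrA JJ mulrN Ie opprK !scalerN !scaleNr.
by rewrite addrC.
Qed.
(** The quaternions are generated by i and j, so compatibility with left multiplication by these two
    suffices. *)
Lemma qmapM : {morph qmap e I J : p q / p * q}.
Proof.
elim/quat_ind=> a b c d q.
have -> : qmap e I J (quat a b c d) * qmap e I J q =
    a *: qmap e I J q + b *: (I * qmap e I J q) +
    (c *: (J * qmap e I J q) + d *: (I * (J * qmap e I J q))).
  rewrite {1}/qmap /= !mulrDl -!scalerAl -!mulrA; congr (a *: _ + _ + _).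
  elim/quat_ind: q => a' b' c' d'; rewrite /= !mulrDr -!scalerAr (proj1 (qt_id eIJ)).
  by rewrite mulrA !(proj1 (qt_I eIJ)) (proj1 (qt_J eIJ)).
elim/quat_ind: q => a' b' c' d'.
rewrite qmapJ !qmapI -!linearZ -!linearD; congr qmap.
by rewrite hmulE !qscaleE [X in _ = X + _]qaddE [X in _ = _ + X]qaddE qaddE; congr quat; ring.
Qed.

End QuaternionTriple.

Lemma qoppE (k : fieldType) (a b c d : k) : - quat a b c d = quat (- a) (- b) (- c) (- d).
Proof. by []. Qed.

Lemma qone_quat (k : fieldType) : 1 = quat 1 0 0 0 :> quaternion k.
Proof. by []. Qed.

Lemma quat_units_triple (k : fieldType) :
  quat_triple (1 : quaternion k) (quat 0 1 0 0) (quat 0 0 1 0).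
Proof.
split; rewrite /corner ?mul1r ?mulr1 // ?qone_quat !hmulE ?qoppE; congr quat; ring.
Qed.

Lemma qmap_units (k : fieldType) (q : quaternion k) :
  qmap (1 : quaternion k) (quat 0 1 0 0) (quat 0 0 1 0) q = q.
Proof.
elim/quat_ind: q => a b c d; rewrite /= hmulE qone_quat !qscaleE.
by rewrite [X in X + _]qaddE [X in _ + X]qaddE qaddE; congr quat; ring.
Qed.

(** * The theorem of Frobenius *)

(** If q has norm zero, [qnorm0_sum2] applies. Otherwise q is invertible, so e itself is [rank_one];
    then I = e I e = c e and c^2 = -1. *)
Lemma rank_one_quat (k : fieldType) (A : falgType k) (e I J : A) q :
  quat_triple e I J -> e != 0 -> q != 0 -> rank_one (qmap e I J q) ->
  exists x y : k, x ^+ 2 + y ^+ 2 = -1.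
Proof.
move=> eIJ e0 q0 q1; have [N0|N0] := eqVneq (qnorm q) 0; first exact: qnorm0_sum2 N0.
have : rank_one e.
  have := @rank_one_mul _ _ _ 1 (qmap e I J ((qnorm q)^-1 *: qconj q)) q1.
  by rewrite mul1r -(qmapM eIJ) -scalerAr hmul_conj scalerA mulVf // scale1r qmap1.
move=> /(_ I)[c]; have [_ [eI Ie] _ II _ _] := eIJ; rewrite eI Ie => Ic.
exists c, 0; rewrite expr0n addr0; apply/eqP; rewrite -subr_eq0 opprK.
have : (c ^+ 2 + 1) *: e == 0.
  rewrite scalerDl scale1r addr_eq0 -II Ic -scalerAr -scalerAl scalerA.
  by rewrite (proj1 (qt_id eIJ)).
by rewrite scaler_eq0 (negPf e0) orbF.
Qed.

Section RealClosed.
Variable R : rcfType.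

Lemma real_sum2 (x y : R) : x ^+ 2 + y ^+ 2 <> -1.
Proof. by apply/eqP; rewrite gt_eqF // (lt_le_trans (ltrN10 _)) // addr_ge0 ?sqr_ge0. Qed.

Lemma qnorm_eq0 (q : quaternion R) : (qnorm q == 0) = (q == 0).
Proof.
apply/eqP/eqP => [N0|->]; last by rewrite /= !expr0n !addr0.
by apply/eqP/negPn/negP => /qnorm0_sum2 /(_ N0)[x [y /real_sum2]].
Qed.

(* Over R[i], p^2 is the product of the factorization of p and its conjugate. *)
Lemma real_sqr_factor (p : {poly R}) : p != 0 ->
  exists (r : seq (R * R)) (c : R), c != 0 /\
    p ^+ 2 = c *: \prod_(z <- r) (('X - z.1%:P) ^+ 2 + (z.2 ^+ 2)%:P).
Proof.
move=> p0; pose h := real_complex R; have hi : injective h by apply: fmorph_inj.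
have [r pr] := closed_field_poly_normal (map_poly h p).
rewrite lead_coef_map in pr.
exists [seq (complex.Re z, complex.Im z) | z <- r], (lead_coef p ^+ 2).
split; first by rewrite expf_neq0 // lead_coef_eq0.
apply: (map_poly_inj h); rewrite rmorphXn /= big_map map_polyZ rmorph_prod /=.
have pc : map_poly h p = map_poly conjc (map_poly h p).
  by rewrite -map_poly_comp; apply: eq_map_poly => x /=; rewrite oppr0.
have hR y : conjc (h y) = h y := conjc_real y.
rewrite expr2 {1}pc pr map_polyZ [X in X *: map_poly _ _](hR (lead_coef p)).
rewrite rmorph_prod -scalerAl -scalerAr scalerA -big_split /=.
rewrite -[X in X *: _]rmorphM -expr2; congr (_ *: _).
apply: eq_bigr => -[a b] _ /=; rewrite !rmorphB /= !map_polyX !map_polyC /=.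
rewrite rmorphD rmorphXn rmorphB /= !map_polyX !map_polyC /=.
have -> : (a -i* b)%C = a%:C%C - 'i%C * b%:C%C by rewrite [LHS]complexE /= rmorphN mulrN.
have -> : (a +i* b)%C = a%:C%C + 'i%C * b%:C%C by rewrite [LHS]complexE.
have -> : (b ^+ 2)%:C%C = - ('i%C * b%:C%C) ^+ 2 by rewrite exprMn sqr_i mulN1r opprK rmorphXn.
rewrite !(rmorphD, rmorphN, rmorphXn) /=; ring.
Qed.

Section Frobenius.
Variables (A : falgType R) (e : A).
Hypotheses (csA : central_simple A) (eD : division_idem e).
Implicit Types x y : A.

Lemma corner_lin a x y : corner e x -> corner e y -> corner e (a *: x + y).
Proof.
move=> [ex xe] [ey ye]; split.
  by rewrite mulrDr -scalerAr ex ey.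
by rewrite mulrDl -scalerAl xe ye.
Qed.

Lemma corner_integral x y : corner e x -> corner e y -> x * y = 0 -> x = 0 \/ y = 0.
Proof.
move=> ex [ey _] xy; have [|x0] := eqVneq x 0; [by left | right].
have [x' [_ _ x'x]] := didem_inv eD ex x0.
by rewrite -ey -x'x -mulrA xy mulr0.
Qed.

Lemma alg_poly_annul (x : A) : exists2 p : {poly R}, p != 0 & horner_alg x p = 0.
Proof.
pose n := \dim {:A}; pose X := [tuple x ^+ i | i < n.+1].
have : ~ free X.
  rewrite /free size_tuple => /eqP Xn.
  by have := dimvS (subvf <<X>>); rewrite Xn ltnn.
move=> /(contra_not (introT freeP)) /existsNP[c /not_implyP[c0 /existsNP[i /eqP ci]]].
exists (\poly_(j < n.+1) c (inord j)).
  apply: contraNneq ci => p0; have := coef_poly n.+1 (fun j => c (inord j)) i.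
  by rewrite p0 coef0 ltn_ord inord_val => <-.
rewrite poly_def rmorph_sum -[RHS]c0; apply: eq_bigr => j _ /=.
rewrite -mul_polyC rmorphM /= rmorphXn /= horner_algX horner_algC.
by rewrite inord_val nth_mktuple mulr_algl.
Qed.

(** Some nonzero real polynomial kills x, and its square is a product of factors (X - a)^2 + b^2. As
    eAe is a division ring, one of these factors already kills x. *)
Lemma corner_quadratic x : corner e x ->
  exists a b : R, (x - a *: e) ^+ 2 = - (b ^+ 2 *: e).
Proof.
move=> ex; have [p p0 px] := alg_poly_annul x.
have [r [c [c0 pr]]] := real_sqr_factor p0.
have : e * horner_alg x (\prod_(z <- r) (('X - z.1%:P) ^+ 2 + (z.2 ^+ 2)%:P)) = 0.
  suff -> : \prod_(z <- r) (('X - z.1%:P) ^+ 2 + (z.2 ^+ 2)%:P) = (c^-1%:P * p) * p.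
    by rewrite rmorphM /= px !mulr0.
  by rewrite mul_polyC -scalerAl -expr2 pr scalerA mulVf // scale1r.
pose q (z : R * R) := (x - z.1 *: e) ^+ 2 + z.2 ^+ 2 *: e.
have eq z : corner e (q z).
  rewrite /q addrC; apply: corner_lin; first exact: didem_id eD.
  rewrite expr2; apply: corner_mul; rewrite addrC -scaleNr; apply: corner_lin => //;
    exact: didem_id eD.
(* Polynomials are evaluated in A, whose unit is 1; multiplication by e moves the evaluation to eAe,
   whose unit is e. *)
have qE z : e * horner_alg x (('X - z.1%:P) ^+ 2 + (z.2 ^+ 2)%:P) = q z.
  rewrite rmorphD rmorphXn rmorphB /= horner_algX !horner_algC.
  have el : e * (x - z.1%:A) = x - z.1 *: e.
    by rewrite mulrBr (proj1 ex) -scalerAr mulr1.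
  rewrite mulrDr !expr2 mulrA el -scalerAr mulr1; congr (_ + _).
  rewrite -[X in _ = _ * X]el mulrA; congr (_ * _).
  by rewrite mulrBl (proj2 ex) -scalerAl (proj1 (didem_id eD)).
elim: r {p p0 px pr} => [|z r IHr].
  by rewrite big_nil rmorph1 mulr1 => /eqP; rewrite (negPf (didem_neq0 eD)).
rewrite big_cons rmorphM mulrA qE; have [q0 _|q0 qQ] := eqVneq (q z) 0.
  by exists z.1, z.2; apply/eqP; rewrite -addr_eq0; apply/eqP.
apply: IHr; have [y [_ _ yq]] := didem_inv eD (eq z) q0.
by rewrite -yq -mulrA qQ mulr0.
Qed.

Hypothesis nR : exists2 x, corner e x & forall t : R, x <> t *: e.

Lemma corner_sqrtN1 x : corner e x -> (forall t : R, x <> t *: e) ->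
  exists a b : R, [/\ b != 0, corner e (b *: (x - a *: e))
    & (b *: (x - a *: e)) * (b *: (x - a *: e)) = - e].
Proof.
move=> ex xR; have [a [b xab]] := corner_quadratic ex.
have exa : corner e (x - a *: e).
  by rewrite addrC -scaleNr; apply: corner_lin => //; apply: didem_id eD.
have b0 : b != 0.
  apply/eqP => b0; move: xab; rewrite b0 expr0n scale0r oppr0 expr2.
  by move/(corner_integral exa exa) => -[] /eqP; rewrite subr_eq0 => /eqP /xR.
exists a, b^-1; split; first by rewrite invr_neq0.
  by rewrite -[_ *: _]addr0; apply: corner_lin => //; split; rewrite ?mulr0 ?mul0r.
rewrite -scalerAl -scalerAr scalerA -[(x - _) * _]expr2 xab scalerN scalerA.
by rewrite -expr2 -exprMn mulVf // expr1n scale1r.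
Qed.

(** With y = x - a e one has y^2 = (b I)^2, and as y commutes with I this factors as (y - b I)(y + b
    I) = 0 in a ring without zero divisors. *)
Lemma corner_commutant I x : corner e I -> I * I = - e -> corner e x ->
  x * I = I * x -> exists a b : R, x = a *: e + b *: I.
Proof.
move=> eI II ex xI; have [a [b xab]] := corner_quadratic ex.
have exa s : corner e (x - a *: e + s *: I).
  rewrite addrC; apply: corner_lin => //.
  by rewrite addrC -scaleNr; apply: corner_lin => //; apply: didem_id eD.
have yI : (x - a *: e) * I = I * (x - a *: e).
  by rewrite mulrBl mulrBr xI -scalerAl -scalerAr (proj1 eI) (proj2 eI).
have : (x - a *: e + (- b) *: I) * (x - a *: e + b *: I) = 0.
  rewrite expr2 in xab; move: (x - a *: e) xab yI => y yy yI.
  rewrite mulrDl !mulrDr -!scalerAl -!scalerAr yI II yy scalerN !scaleNr scalerN.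
  by rewrite scalerA expr2 opprK addrA addrK addNr.
move/(corner_integral (exa _) (exa _)) => -[] /eqP; rewrite addr_eq0 subr_eq => /eqP->.
  by exists a, b; rewrite scaleNr opprK addrC.
by exists a, (- b); rewrite scaleNr addrC.
Qed.

Lemma scale_double (x : A) : x + x = 0 -> x = 0.
Proof.
by move/eqP; rewrite -mulr2n -scaler_nat scaler_eq0 pnatr_eq0 => /eqP.
Qed.

Lemma quaternion_corner : exists I J, quat_triple e I J /\
  forall x, corner e x -> exists q, qmap e I J q = x.
Proof.
have ee := didem_id eD; have e0 := didem_neq0 eD.
have [x0 ex0 /(corner_sqrtN1 ex0)[a [b [_]]]] := nR.
move: (b *: _) => I eI II {x0 ex0 a b}; exists I.
(* x + I x I anticommutes with I and x - I x I commutes with I. *)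
have ep x : corner e x -> corner e (x + I * x * I) /\ corner e (x - I * x * I).
  move=> ex; have eIx : corner e (I * x * I) by do !apply: corner_mul.
  split; first by rewrite -[x]scale1r; apply: corner_lin; rewrite ?scale1r.
  by rewrite addrC -scaleN1r; apply: corner_lin.
have IIm x : corner e x -> I * (I * x) = - x by move=> [ex _]; rewrite mulrA II mulNr ex.
have mII x : corner e x -> x * I * I = - x by move=> [_ xe]; rewrite -mulrA II mulrN xe.
have antiE x : corner e x -> (x + I * x * I) * I = x * I - I * x.
  by move=> ex; rewrite mulrDl mII //; apply: corner_mul.
have anti x : corner e x -> (x + I * x * I) * I = - (I * (x + I * x * I)).
  move=> ex; rewrite antiE // mulrDr -[I * x * I]mulrA IIm ?opprB //.
  exact: corner_mul.
have comm x : corner e x -> (x - I * x * I) * I = I * (x - I * x * I).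
  move=> ex; rewrite mulrBl mII ?mulrBr; last exact: corner_mul.
  by rewrite -[I * x * I in RHS]mulrA IIm ?opprK 1?addrC //; apply: corner_mul.
(* If no nonzero element anticommuted with I, then I would be central in eAe, hence a real scalar
   with square -1. *)
have [y [ey y0 yI]] : exists y, [/\ corner e y, y != 0 & y * I = - (I * y)].
  apply: contrapT => ny; have [|c Ic] := corner_center csA eD eI.
    move=> x ex; apply/eqP; rewrite -subr_eq0; apply/negPn/negP => xI.
    apply: ny; exists (x + I * x * I); split; [by case: (ep x ex) | | exact: anti].
    by apply: contraNneq xI => x0; rewrite -antiE // x0 mul0r.
  have := II; rewrite Ic -scalerAl -scalerAr scalerA (proj1 ee) => /eqP.
  rewrite -subr_eq0 opprK -[X in _ + X]scale1r -scalerDl scaler_eq0 (negPf e0) orbF.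
  by rewrite addr_eq0 -expr2 => /eqP c2; case: (@real_sum2 c 0); rewrite expr0n addr0.
have Iy0 : I * y != 0.
  by apply: contraNneq y0 => Iy; rewrite -[y]opprK -(IIm y ey) Iy mulr0 oppr0.
(* y y commutes with I, so it is s e + t I; as it also commutes with y, which anticommutes with I, t
   vanishes. *)
have [s yy] : exists s : R, y * y = s *: e.
  have [|s [t yst]] := corner_commutant eI II (corner_mul ey ey).
    by rewrite -mulrA yI mulrN [y * (I * y)]mulrA yI mulNr opprK mulrA.
  suff t0 : t = 0 by exists s; rewrite yst t0 scale0r addr0.
  have : y * (y * y) = y * y * y by rewrite mulrA.
  rewrite yst mulrDr mulrDl -!scalerAr -!scalerAl (proj1 ey) (proj2 ey) yI => /addrI.
  rewrite scalerN => /eqP; rewrite eq_sym -subr_eq0 opprK => /eqP/scale_double/eqP.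
  by rewrite scaler_eq0 (negPf Iy0) orbF => /eqP.
(* For s >= 0 the equation y^2 = s e would factor and make y a scalar, which cannot anticommute with
   I. *)
have s0 : s < 0.
  rewrite ltNge; apply/negP => s0; move/negP: Iy0; apply; apply/eqP.
  suff [c yc] : exists c : R, y = c *: e.
    apply: scale_double; rewrite -{2}[I * y]opprK -yI yc -scalerAl -scalerAr.
    by rewrite (proj1 eI) (proj2 eI) subrr.
  have eyc c : corner e (y + c *: e) by rewrite addrC; apply: corner_lin.
  have : (y + (- Num.sqrt s) *: e) * (y + Num.sqrt s *: e) = 0.
    rewrite mulrDl !mulrDr -!scalerAl -!scalerAr (proj1 ey) (proj2 ey) (proj1 ee) yy.
    by rewrite scalerA mulNr -expr2 sqr_sqrtr // !scaleNr addrA addrK subrr.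
  case/(corner_integral (eyc _) (eyc _)) => /eqP; rewrite addr_eq0 => /eqP->.
    by exists (Num.sqrt s); rewrite scaleNr opprK.
  by exists (- Num.sqrt s); rewrite scaleNr.
have s1 : Num.sqrt (- s) != 0 by rewrite sqrtr_eq0 -ltNge oppr_gt0.
pose J := (Num.sqrt (- s))^-1 *: y.
have eJ : corner e J.
  by rewrite /J -[_ *: _]addr0; apply: corner_lin => //; split; rewrite ?mulr0 ?mul0r.
have JJ : J * J = - e.
  rewrite /J -scalerAl -scalerAr scalerA yy scalerA -expr2 exprVn sqr_sqrtr ?oppr_ge0 ?ltW //.
  by rewrite invrN mulNr mulVf ?scaleN1r // lt_eqF.
have JI : J * I = - (I * J) by rewrite /J -scalerAl yI -scalerAr scalerN.
exists J; split=> [|x ex]; first by split.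
(* 2 x is the sum of a part commuting with I and a part anticommuting with I. The product of the
   second part with J commutes with I, so both are controlled by [corner_commutant]. *)
have [ep1 ep2] := ep x ex.
have [a [b xab]] := corner_commutant eI II ep2 (comm x ex).
have [|c [d xcd]] := corner_commutant eI II (corner_mul ep1 eJ).
  move: ep1 (anti x ex); move: (x + _) => z ez zI.
  by rewrite -mulrA JI mulrN [z * (I * J)]mulrA zI mulNr opprK mulrA.
have {}xcd : x + I * x * I = - (c *: J + d *: (I * J)).
  have := congr1 (fun z => - (z * J)) xcd.
  rewrite /= -[_ * J * J]mulrA JJ mulrN (proj2 ep1) opprK => ->.
  by rewrite mulrDl -!scalerAl (proj1 eJ).
exists (quat (a / 2%:R) (b / 2%:R) (- c / 2%:R) (- d / 2%:R)).
have q2 : qmap e I J (quat a b (- c) (- d)) = x + x.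
  by rewrite /= -xab !scaleNr -opprD -xcd addrACA addNr addr0.
have -> : quat (a / 2%:R) (b / 2%:R) (- c / 2%:R) (- d / 2%:R) =
    2%:R^-1 *: quat a b (- c) (- d) by rewrite qscaleE; congr quat; rewrite mulrC.
by rewrite qmapZ q2 -mulr2n -scaler_nat scalerA mulVf ?pnatr_eq0 // scale1r.
Qed.

End Frobenius.

Lemma csa_matrix_model (A : falgType R) : central_simple A ->
  matrix_model (R^o : falgType R) A \/ matrix_model (quaternion R) A.
Proof.
move=> csA; have [e eD] := exists_division_idem csA.
have [n [v [w vw]]] := exists_matrix_frame csA eD; have e0 := didem_neq0 eD.
have [[x ex xR]|nR] := pselect (exists2 x, corner e x & forall t : R, x <> t *: e).
  have [I [J [eIJ eq]]] := quaternion_corner csA eD (ex_intro2 _ _ x ex xR).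
  right; exists n, v, w, (qmap e I J); split.
  - by rewrite [X in matrix_frame X](qmap1 e I J).
  - exact: qmapM.
  - apply: raddf_inj => q q0; apply/eqP; rewrite -qnorm_eq0.
    have : qmap e I J (q * qconj q) = 0 by rewrite (qmapM eIJ) [X in X * _]q0 mul0r.
    by rewrite hmul_conj qmapZ qmap1 => /eqP; rewrite scaler_eq0 (negPf e0) orbF.
  - by move=> x'; rewrite [X in corner X](qmap1 e I J); apply: eq.
left; apply: split_matrix_model vw _ => x ex; apply: contrapT => xR.
by apply: nR; exists x => // t xt; apply: xR; exists t.
Qed.

Lemma quaternion_inv (q : quaternion R) : q != 0 -> exists p, q * p = 1.
Proof.
rewrite -qnorm_eq0 => q0; exists ((qnorm q)^-1 *: qconj q).
by rewrite -scalerAr hmul_conj scalerA mulVf // scale1r.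
Qed.

Lemma quaternion_csa : central_simple (quaternion R).
Proof.
split=> [z zC|I I_ideal].
  have := zC (quat 0 0 1 0); have := zC (quat 0 1 0 0); move: z {zC}.
  elim/quat_ind=> a b c d; rewrite !hmulE => -[_ _ d0 c0] [_ _ _ b0].
  exists a; rewrite -[RHS]/(_ *: quat 1 0 0 0) qscaleE !mulr0 mulr1.
  by congr quat; lra.
have [->|I0] := eqVneq I 0%VS; [by left | right].
have p0 : vpick I != 0 by rewrite vpick0.
have [p pq] := quaternion_inv p0.
apply/eqP; rewrite eqEsubv subvf; apply/subvP => x _.
have [_] := I_ideal p _ (memv_pick I); rewrite pq => I1.
by have [] := I_ideal x _ I1; rewrite mulr1.
Qed.

(** A nonzero [rank_one] element of a division algebra is invertible, so 1 is [rank_one] too and the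
    quaternion i would be a scalar. *)
Lemma quaternion_not_split : ~ brauer_equiv (R^o : falgType R) (quaternion R).
Proof.
move=> /rank_one_brauer RH; have [|b b0 b1] := RH.
  by exists 1; [exact: oner_neq0 | move=> x; exists x; rewrite mul1r mulr1 [RHS]mulr1].
have [p bp] := quaternion_inv b0.
have [c] := @rank_one_mul _ _ _ 1 p b1 (quat 0 1 0 0).
rewrite mul1r bp mul1r mulr1 => -[_ /eqP].
by rewrite [_ *: _]mulr0 oner_eq0.
Qed.

End RealClosed.

(** * Extension of scalars *)

Section ScalarExtension.
Variables (k K : fieldType) (i : {rmorphism k -> K}).

Section Algebra.
Variable A : falgType k.
Local Notation AK := (scalar_ext i A).
Local Notation se := (@se_in _ _ i A).

Lemma se_mulE x y : se (x * y) = se x * se y.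
Proof. exact: se_inM. Qed.
Lemma se_one1 : se 1 = 1. Proof. by []. Qed.
Lemma se_oppE x : se (- x) = - se x.
Proof. by rewrite -scaleN1r se_inZ rmorphN1 scaleN1r. Qed.

Lemma se_eq0 x : se x = 0 -> x = 0.
Proof.
move/rowP=> x0; rewrite [x]basis_sum big1 // => p _.
by have /eqP := x0 p; rewrite !mxE fmorph_eq0 => /eqP->; rewrite scale0r.
Qed.

Lemma se_sandwich (a b : A) (u : AK) : se a * u * se b =
  \sum_p (u : 'rV_(\dim {:A})) 0 p *: se (a * (vbasis {:A})`_p * b).
Proof.
rewrite {1}[u]se_span mulr_sumr mulr_suml; apply: eq_bigr => p _.
by rewrite -scalerAr -scalerAl !se_mulE.
Qed.

(** The map u |-> a u a is linear, so the property need only be read off on a basis coming from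
    A. *)
Lemma se_rank_one (a : A) : rank_one a -> rank_one (se a).
Proof.
move=> /choice[c ac] u; eexists; rewrite se_sandwich.
under eq_bigr do rewrite ac se_inZ scalerA.
by rewrite -scaler_suml.
Qed.

Lemma se_corner (e x : A) : corner e x -> corner (se e) (se x).
Proof. by move=> [ex xe]; split; rewrite -se_mulE ?ex ?xe. Qed.

Lemma se_frame (e : A) n (v w : 'I_n -> A) : matrix_frame e v w ->
  matrix_frame (se e) (se \o v) (se \o w).
Proof.
move=> [ee ev we vw vw1]; split=> [|p|p|p q|] /=; rewrite -?se_mulE ?ev ?we //.
- exact: se_corner.
- by rewrite vw; case: eqP => _ //; apply: se_in0.
- under eq_bigr do rewrite -se_mulE.
  by rewrite -se_in_sum vw1.
Qed.

Lemma se_quat_triple (e I J : A) : quat_triple e I J -> quat_triple (se e) (se I) (se J).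
Proof.
move=> [ee eI eJ II JJ JI]; split; rewrite -?se_mulE ?II ?JJ ?JI ?se_oppE //;
  exact: se_corner.
Qed.

Lemma se_qmap (e I J : A) a b c d : se (qmap e I J (quat a b c d)) =
  qmap (se e) (se I) (se J) (quat (i a) (i b) (i c) (i d)).
Proof. by rewrite /= !se_inD !se_inZ se_mulE. Qed.

Lemma se_qmap_corner (e I J : A) : (forall x, corner e x -> exists q, qmap e I J q = x) ->
  corner e e -> forall u, corner (se e) u -> exists q, qmap (se e) (se I) (se J) q = u.
Proof.
move=> eS ee u [eu ue].
have /choice[q qx] : forall x, exists q, qmap (se e) (se I) (se J) q = se (e * x * e).
  move=> x; have [|q <-] := eS (e * x * e).
    exact: corner_sandwich.
  by elim/quat_ind: q => a b c d; eexists; rewrite se_qmap.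
rewrite -ue -eu se_sandwich; under eq_bigr do rewrite -qx -qmapZ.
by eexists; rewrite -linear_sum.
Qed.

End Algebra.

(** The unit of the corner k of A is [rank_one]. Its class-invariant counterpart in B over K has a
    nonzero matrix entry, which lies in the quaternion corner, where [rank_one_quat] concludes. *)
Lemma split_quat_sum2 (A B : falgType k) :
  matrix_model (k^o : falgType k) A -> matrix_model (quaternion k) B ->
  brauer_equiv (scalar_ext i A) (scalar_ext i B) -> exists x y : K, x ^+ 2 + y ^+ 2 = -1.
Proof.
move=> [_ [_ [_ [Q [[ee _ _ _ _] _ Qi Qs]]]]] [n [v [w [P [vw PM Pi Ps]]]]].
move=> /rank_one_brauer ABK; have {ABK}[|b b0 b1] := ABK.
  exists (se_in i (Q 1)).
    by apply/eqP => /se_eq0 Q1; move: (oner_neq0 k); rewrite -(inj_eq Qi) Q1 linear0 eqxx.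
  apply: se_rank_one => x; have [|t tx] := Qs (Q 1 * x * Q 1).
    exact: corner_sandwich.
  exists t; rewrite -tx -linearZ; congr (Q _).
  by rewrite [RHS]mulr1.
have vwK := se_frame vw.
have [p [q vbw]] : exists p q, se_in i (v p) * b * se_in i (w q) != 0.
  apply: contrapT => vbw; move/eqP: b0; apply; rewrite -(frame_expand b vwK).
  rewrite big1 // => p _; rewrite big1 // => q _ /=; rewrite [X in _ * X * _](_ : _ = 0).
    by rewrite mulr0 mul0r.
  by apply/eqP/negPn/negP => ?; apply: vbw; exists p, q.
have := rank_one_mul (se_in i (v p)) (se_in i (w q)) b1.
have eIJ : quat_triple (P 1) (P (quat 0 1 0 0)) (P (quat 0 0 1 0)).
  have [ee1 eI eJ II JJ JI] := quat_units_triple k.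
  have Pc x : corner 1 x -> corner (P 1) (P x).
    by move=> [e1 e2]; split; rewrite -PM ?e1 ?e2.
  by split; rewrite -?PM ?II ?JJ ?JI ?linearN //; apply: Pc.
have PS x : corner (P 1) x -> exists t, qmap (P 1) (P (quat 0 1 0 0)) (P (quat 0 0 1 0)) t = x.
  move=> /Ps[t <-]; exists t; rewrite -[in RHS](qmap_units t).
  elim/quat_ind: t => a b' c d.
  by rewrite /qmap /quat !linearD !linearZ PM.
have bc := frame_corner b p q vwK.
have [t tb] := se_qmap_corner PS (frame_id vw) bc.
rewrite -[_ * b * _]tb; apply: rank_one_quat (se_quat_triple eIJ) _ _.
  apply/eqP => /se_eq0 P1; move: (oner_neq0 (quaternion k)).
  by rewrite -(inj_eq Pi) P1 linear0 eqxx.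
apply: contraNneq vbw => t0; apply/eqP; rewrite -[LHS]tb t0.
exact: (linear0 (qmap _ _ _)).
Qed.

Lemma split_regular_ext : matrix_model (K^o : falgType K) (scalar_ext i (k^o : falgType k)).
Proof.
apply: (@split_matrix_model _ _ 1 0 (fun=> 1) (fun=> 1)).
  split=> [|p|p|p q|]; rewrite /corner ?mul1r ?mulr1 //.
  - by rewrite !ord1.
  - by rewrite big_ord1 ?mulr1.
move=> x _; rewrite [x]se_span; eexists.
have e p : se_in i (vbasis {:(k^o : falgType k)})`_p =
    i ((vbasis {:(k^o : falgType k)})`_p) *: (1 : scalar_ext i (k^o : falgType k)).
  by rewrite -(@se_one1 (k^o : falgType k)) -se_inZ; congr se_in; rewrite [RHS]mulr1.
by under eq_bigr do rewrite e scalerA; rewrite -scaler_suml.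
Qed.

(* With S := - x J + y I J one has S^2 = 1 and S I = - I S, and (1 + S) / 2   *)
(* is an idempotent of rank one.                                              *)
Lemma quaternion_frame (x y : K) : x ^+ 2 + y ^+ 2 = -1 -> 2%:R != 0 :> K ->
  exists e (v w : 'I_2 -> quaternion K),
    matrix_frame e v w /\ forall q, exists t : K, e * q * e = t *: e.
Proof.
move=> xy two0; pose I : quaternion K := quat 0 1 0 0.
have [S SE] : exists S : quaternion K, S = quat 0 0 (- x) y by eexists.
have SS : S * S = 1.
  rewrite SE hmulE qone_quat; congr quat; try ring.
  by transitivity (- (x ^+ 2 + y ^+ 2)); [ring | rewrite xy opprK].
have II : I * I = -1 by rewrite /I hmulE qone_quat qoppE; congr quat; ring.
have SI : S * I = - (I * S) by rewrite SE /I !hmulE qoppE; congr quat; ring.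
have gen q : exists a b c d : K, q = a *: 1 + b *: I + (c *: S + d *: (I * S)).
  elim/quat_ind: q => a b c d; exists a, b, (c * x - d * y), (c * y + d * x).
  rewrite SE /I hmulE qone_quat !qscaleE [X in X + _]qaddE [X in _ + X]qaddE qaddE.
  congr quat; try ring.
  - transitivity (- c * (x ^+ 2 + y ^+ 2)); last by ring.
    by rewrite xy mulrN1 opprK.
  - transitivity (- d * (x ^+ 2 + y ^+ 2)); last by ring.
    by rewrite xy mulrN1 opprK.
move: I S SS II SI gen {SE} => I S SS II SI gen.
have [e eE] : exists e : quaternion K, e = 2%:R^-1 *: (1 + S) by eexists.
have eS : e * S = e by rewrite eE -scalerAl mulrDl mul1r SS addrC.
have Se : S * e = e by rewrite eE -scalerAr mulrDr mulr1 SS addrC.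
have e2 z : 2%:R^-1 *: (z + z) = z :> quaternion K.
  by rewrite -mulr2n -scaler_nat scalerA mulVf // scale1r.
have ee : e * e = e by rewrite {2}eE -scalerAr mulrDr mulr1 eS e2.
have eI : e * I = I * (1 - e).
  have -> : 1 - e = 2%:R^-1 *: (1 - S).
    by rewrite -{1}(e2 1) eE -scalerBr opprD addrA addrK.
  by rewrite eE -scalerAl mulrDl mul1r SI -scalerAr mulrBr mulr1.
have eIe : e * I * e = 0 by rewrite eI -mulrA mulrBl mul1r ee subrr mulr0.
(* Conjugation by I exchanges e and 1 - e, and I e * (- e I) = 1 - e supplies the second diagonal
   idempotent. *)
exists e, (fun p => if p == 0 then e else - (e * I)), (fun p => if p == 0 then e else I * e).
split; last first.
  move=> q; have [a [b [c [d ->]]]] := gen q; exists (a + c).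
  rewrite !mulrDr !mulrDl -!scalerAr -!scalerAl mulr1 ee eIe eS ee scaler0 addr0.
  by rewrite [e * (I * S)]mulrA -[_ * S * e]mulrA Se eIe scaler0 addr0 scalerDl.
split=> [//|p|p|p q|].
- by case: (p == 0); rewrite ?mulrN ?mulrA ee.
- by case: (p == 0); rewrite -?mulrA ee.
- case: p q => [[|[]]//= p] [[|[]]//= q]; rewrite ?ee // ?mulNr ?mulrA ?eIe ?oppr0 //.
  by rewrite -(mulrA e) II mulrN1 mulNr opprK ee.
- rewrite !big_ord_recl big_ord0 addr0 /= ee mulrN mulrA -(mulrA I) ee.
  by rewrite -mulrA eI mulrA II mulN1r opprK addrC subrK.
Qed.

Lemma split_quaternion_ext (x y : K) : x ^+ 2 + y ^+ 2 = -1 -> 2%:R != 0 :> K ->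
  matrix_model (K^o : falgType K) (scalar_ext i (quaternion k)).
Proof.
move=> xy two0; have [e [v [w [vw eS]]]] := quaternion_frame xy two0.
pose f := qmap (se_in i 1 : scalar_ext i (quaternion k)) (se_in i (quat 0 1 0 0))
  (se_in i (quat 0 0 1 0)).
have eIJ := se_quat_triple (quat_units_triple k).
have fM p q : f (p * q) = f p * f q by apply: qmapM.
have f1 : f 1 = 1 by apply: qmap1.
have f0 : f 0 = 0 by apply: (linear0 (qmap _ _ _)).
have fs u : exists q, f q = u.
  apply: se_qmap_corner; [|by split; rewrite mul1r|by split; rewrite ?mul1r ?mulr1].
  by move=> q _; exists q; apply: qmap_units.
have fZ t q : f (t *: q) = t *: f q by apply: qmapZ.
have [[ee _] ev we vwd vw1] := vw.
apply: (@split_matrix_model _ _ (f e) 1 (f \o v) (f \o w)) => [|u [eu ue]]; last first.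
  have [q qu] := fs u; have [t te] := eS q; exists t.
  by rewrite -fZ -te !fM qu eu ue.
split=> [|p|p|p q|] /=; rewrite -?fM ?ev ?we //.
- by split; rewrite -fM ee.
- by rewrite vwd; case: eqP.
- under eq_bigr do rewrite -fM.
  by rewrite -f1 -vw1; apply/esym/(linear_sum (qmap _ _ _)).
Qed.

End ScalarExtension.

(** A solution splits H over K, so R and H acquire the same class. Without one, algebras equivalent
    over K are of the same type over R, hence equivalent there. *)
Lemma brauer_injective_sum2 (R : rcfType) (K : fieldType) (i : {rmorphism R -> K}) :
  brauer_injective i <-> ~ exists x y : K, x ^+ 2 + y ^+ 2 = -1.
Proof.
split=> [iinj [x [y xy]]|nxy A B csA csB AB].
  apply: (@quaternion_not_split R); apply: iinj; last 1 first.
  - apply: matrix_model_brauer (split_regular_ext i) _.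
    apply: split_quaternion_ext xy _.
    by rewrite -(rmorph_nat i) fmorph_eq0 pnatr_eq0.
  - split=> [z _|I _]; first by exists z; rewrite [RHS]mulr1.
    have [->|I0] := eqVneq I 0%VS; [by left | right].
    by apply/eqP; rewrite eqEdim subvf regular_fullv dimv1 lt0n dimv_eq0.
  - exact: quaternion_csa.
have [mA|mA] := csa_matrix_model csA; have [mB|mB] := csa_matrix_model csB.
- exact: matrix_model_brauer mA mB.
- by case: nxy; apply: split_quat_sum2 mA mB AB.
- by case: nxy; apply: split_quat_sum2 mB mA (brauer_equiv_sym AB).
- exact: matrix_model_brauer mA mB.
Qed.

(** * Equivariant retractions *)

Definition to_munit (L : fieldType) (x : L) (x0 : x != 0) : munits L := Sub x x0.

Lemma munit_valN (L : fieldType) (x : munits L) : val (- x) = (val x)^-1.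
Proof. by []. Qed.
Lemma munit_valMz (L : fieldType) (x : munits L) n : val (x *~ Posz n) = val x ^+ n.
Proof.
elim: n => [|n IHn]; first by rewrite mulr0z.
by rewrite intS mulrzDr mulr1z exprS -IHn.
Qed.

Section Retraction.
Variables (F : numClosedFieldType) (L : fieldType).
Variables (kap : {rmorphism F -> L}) (t : {rmorphism L -> L}).
Hypotheses (tK : involutive t) (t_kap : forall c, t (kap c) = kap (c^*)).
Hypothesis t_norm : forall w, w * t w != -1.

Local Notation cst := (munit_map kap).
Local Notation tau := (munit_map t).

Lemma munits_divisible n (d : munits F) : exists d', d' *~ Posz n.+1 = d.
Proof.
have r0 : n.+1.-root (val d) != 0 by rewrite rootC_eq0 // (valP d).
by exists (to_munit r0); apply/val_inj; rewrite munit_valMz /= rootCK.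
Qed.

(** A constant norm is fixed by conjugation, hence real; if it were negative, dividing w by the
    square root of - c would produce an element of norm -1. *)
Lemma norm_const_gt0 w c : w != 0 -> w * t w = kap c -> 0 < c.
Proof.
move=> w0 wc; have cR : c \is Num.real.
  apply/CrealP/(fmorph_inj kap); rewrite -t_kap -wc rmorphM.
  by rewrite [t (t w)]tK mulrC.
have c0 : c != 0.
  apply: contra_eq_neq wc => ->; rewrite rmorph0 mulf_neq0 // fmorph_eq0 //.
rewrite real_ltNge ?real0 // le_eqVlt (negPf c0) /=; apply/negP => c_lt0.
have := t_norm (w / kap (sqrtC (- c))).
rewrite rmorphM fmorphV t_kap mulrACA wc -invfM -rmorphM.
rewrite conj_Creal ?ger0_real ?sqrtC_ge0 ?oppr_ge0 ?ltW // -expr2 sqrtCK.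
by rewrite rmorphN invrN mulrN divff ?eqxx // fmorph_eq0.
Qed.

Lemma const_retraction : exists2 h : munits L -> munits F, zmod_morphism h &
  forall c, h (cst c) = c.
Proof.
(* The graph of the inverse of the inclusion of constants; its extension to all of L^* is a
   retraction, not yet equivariant. *)
pose B : set (munits L * munits F) := fun p => p.1 = cst p.2.
have [||h hB hE] := divisible_extension munits_divisible (B := B).
- split=> [x d y c xE yE|d dE].
    by rewrite /B /= in xE yE *; rewrite xE yE munit_map_sub.
  by apply/val_inj/(fmorph_inj kap); have := congr1 val dE; rewrite /= rmorph1.
- by exists (0, 0); apply/val_inj; rewrite /= rmorph1.
by exists h => // c; apply: hE.
Qed.

(** The assignment c * (w * t w) |-> c / |c| is well defined: if the product is 1, then c is the
    norm of the inverse of w, so it is positive by [norm_const_gt0]. *)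
Lemma unit_circle_extension : exists2 g : munits L -> munits F, zmod_morphism g &
  (forall c, val c = `|val c| * val (g (cst c))) /\ forall w, g (w + tau w) = 0.
Proof.
pose B : set (munits L * munits F) := fun p => exists c w,
  p.1 = cst c + (w + tau w) /\ val c = `|val c| * val p.2.
have [||g gB gE] := divisible_extension munits_divisible (B := B).
- split=> [x d x' d' [c [w [xE cd]]] [c' [w' [xE' cd']]]|d [c [w [cw cd]]]].
    rewrite /= in xE cd xE' cd'.
    exists (c - c'), (w - w'); split=> /=.
      by rewrite xE xE' !munit_map_sub !opprD [LHS]addrACA; congr (_ + _); rewrite addrACA.
    by rewrite {1}cd {1}cd' normrM normfV invfM mulrACA.
  have c_gt0 : 0 < val c.
    apply: (@norm_const_gt0 (val w)^-1); first exact: invr_neq0 (valP w).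
    have := congr1 val cw; rewrite /= => /eqP; rewrite eq_sym => /eqP w1.
    have w0 : val w * t (val w) != 0 by rewrite mulf_neq0 ?fmorph_eq0 // (valP w).
    by rewrite fmorphV -invfM; apply: (mulIf w0); rewrite mulVf // w1.
  have c0 : `|val c| != 0 by rewrite normr_eq0 (valP c).
  by apply/val_inj/(mulfI c0); rewrite -[LHS]cd mulr1 gtr0_norm.
- exists (0, 0), 0, 0; split; last by rewrite /= normr1 mulr1.
  by apply/val_inj; rewrite /= !rmorph1 !mulr1.
exists g => //; split=> [c|w].
  have u0 : val c / `|val c| != 0.
    by rewrite mulf_neq0 ?invr_eq0 ?normr_eq0 ?(valP c).
  rewrite (gE _ (to_munit u0)) /= 1?mulrCA ?divff ?mulr1 ?normr_eq0 ?(valP c) //.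
  exists c, 0; split=> /=; last by rewrite mulrCA divff ?mulr1 ?normr_eq0 ?(valP c).
  by apply/val_inj; rewrite /= rmorph1 !mulr1.
apply: gE; exists 0, w; split; last by rewrite /= normr1 mulr1.
by apply/val_inj; rewrite /= rmorph1 mul1r.
Qed.

Lemma equivariant_retraction : exists r : munits L -> munits F,
  [/\ zmod_morphism r, forall c, r (cst c) = c
    & forall x, val (r (tau x)) = (val (r x))^*].
Proof.
have [h hB hE] := const_retraction.
have [g gB [gE gN]] := unit_circle_extension.
pose ha : {additive munits L -> munits F} :=
  HB.pack h (GRing.isZmodMorphism.Build _ _ h hB).
pose ga : {additive munits L -> munits F} :=
  HB.pack g (GRing.isZmodMorphism.Build _ _ g gB).
(* The modulus is the geometric mean over the orbit of x, hence invariant under [tau]. The argument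
   comes from g, normalized because g need not have modulus 1 off the constants; g inverts under
   [tau], and on the unit circle inversion is conjugation. *)
pose ab x := sqrtC (`|val (h x)| * `|val (h (tau x))|).
have ab_ge0 x : 0 <= ab x by rewrite sqrtC_ge0 mulr_ge0.
have ab0 x : ab x != 0.
  by rewrite sqrtC_eq0 mulf_neq0 ?normr_eq0 ?(valP (h _)).
have g0 x : `|val (g x)| != 0 by rewrite normr_eq0 (valP (g x)).
have r0 x : ab x * (val (g x) / `|val (g x)|) != 0.
  by rewrite !mulf_neq0 ?invr_eq0 ?g0 ?ab0 ?(valP (g x)).
pose r x := to_munit (r0 x).
have tauD x y : tau (x + y) = tau x + tau y by apply/val_inj; rewrite /= rmorphM.
have rD x y : r (x + y) = r x + r y.
  apply/val_inj; rewrite /= /ab -[h (x + y)]/(ha _) -[g _]/(ga _) tauD -[h (_ + _)]/(ha _).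
  rewrite !raddfD /= !normrM invfM (mulrACA (val (g x))) (mulrACA `|val (h x)|).
  by rewrite sqrtCM ?nnegrE ?mulr_ge0 // [RHS]mulrACA.
have taut x : tau (tau x) = x by apply/val_inj; rewrite /= tK.
exists r; split=> [x y|c|x].
- by apply: (addIr (r y)); rewrite -rD !addrNK.
- apply/val_inj; rewrite /= /ab hE.
  have -> : tau (cst c) = cst (munit_map Num.conj c) by apply/val_inj; rewrite /= t_kap.
  rewrite hE /= norm_conjC -expr2 sqrCK // mulrA.
  suff -> : `|val (g (cst c))| = 1 by rewrite divr1 [RHS]gE.
  have c0 : `|val c| != 0 by rewrite normr_eq0 (valP c).
  by apply: (mulfI c0); rewrite mulr1 -[in LHS]normr_id -normrM -gE.
rewrite /=.
have -> : ab (tau x) = ab x by rewrite /ab taut mulrC.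
have -> : g (tau x) = - g x.
  by apply/eqP; rewrite -addr_eq0 addrC -[g _ + g _](raddfD ga) [ga _]gN.
rewrite munit_valN normfV invrK !rmorphM /=.
rewrite [(_^-1)^*]conj_Creal ?rpredV ?normr_real //.
rewrite (conj_Creal (ger0_real (ab_ge0 x))); congr (_ * _).
by rewrite [X in X * _ = _]invC_norm mulrAC expr2 invfM mulfVK ?g0 1?mulrC.
Qed.

End Retraction.

(** * Split extensions *)

Section Extensions.
Variable G : groupType.

Lemma bijective_of (T U : Type) (f : T -> U) :
  injective f -> (forall y, exists x, f x = y) -> bijective f.
Proof.
move=> fi /choice[g gK]; exists g => // x; exact/fi/gK.
Qed.

Lemma ext_equiv_refl (M N : gmod G) (e : extension M N) : ext_equiv e e.
Proof.
by exists (@GHom G _ _ (fun x : ext_mod e => x) (fun x y => erefl) (fun g x => erefl));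
  split=> //; exists id.
Qed.

Lemma ext_equiv_sym (M N : gmod G) (e e' : extension M N) : ext_equiv e e' -> ext_equiv e' e.
Proof.
move=> [f [[h fK hK] fi fo]]; have fI := can_inj fK.
have hB : zmod_morphism h by move=> x y; apply: fI; rewrite ghom_sub !hK.
have ha g x : h (gact g x) = gact g (h x) by apply: fI; rewrite ghom_act !hK.
exists (GHom hB ha); split=> [|y|x] /=; first by exists f.
  by apply: fI; rewrite fi hK.
by rewrite -fo hK.
Qed.

Lemma ext_equiv_trans (M N : gmod G) (e e' e'' : extension M N) :
  ext_equiv e e' -> ext_equiv e' e'' -> ext_equiv e e''.
Proof.
move=> [f [fb fi fo]] [h [hb hi ho]].
have cB : zmod_morphism (h \o f) by move=> x y /=; rewrite !ghom_sub.
have ca g x : (h \o f) (gact g x) = gact g ((h \o f) x) by rewrite /= !ghom_act.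
exists (GHom cB ca); split=> [|y|x] /=; first exact: bij_comp.
  by rewrite fi hi.
by rewrite ho fo.
Qed.

(** A retraction r and the projection to the cokernel together map E isomorphically onto the direct
    sum; conversely the first component of such an isomorphism is a retraction. *)
Lemma coker_split (N E : gmod G) (f : ghom N E) (fi : injective f) :
  ext_class (coker_ext fi) = Ext1_zero _ _ <-> exists r : ghom E N, forall x, r (f x) = x.
Proof.
split=> [/(congr1 sval) /= e|[r rf]].
  have : ext_equiv (coker_ext fi) (split_ext (coker f) N) by rewrite e; apply: ext_equiv_refl.
  move=> [h [_ hi _]].
  have rB : zmod_morphism (fun x : E => (h x).1) by move=> x y; rewrite ghom_sub.
  have ra g (x : E) : (h (gact g x)).1 = gact g (h x).1 by rewrite ghom_act.
  by exists (GHom rB ra) => x /=; rewrite hi.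
have eq0 : ext_equiv (coker_ext fi) (split_ext (coker f) N).
  pose h (x : E) : sum_gmod (coker f) N := (r x, coker_pi f x).
  have hB : zmod_morphism h by move=> x y; rewrite /h !ghom_sub.
  have ha g x : h (gact g x) = gact g (h x) by rewrite /h !ghom_act.
  exists (@GHom G E (sum_gmod (coker f) N) h hB ha); split=> [|y|x] //=; last first.
    congr (_, _); first exact: rf.
    by apply/coker_exact; exists y.
  apply: bijective_of => [x y [rxy /coker_projP[z zxy]]|[n m]].
    apply/eqP; rewrite -subr_eq0 -zxy; apply/eqP.
    have : r (x - y) = 0 by rewrite ghom_sub rxy subrr.
    rewrite -zxy rf => ->; by have := ghom_sub f 0 0; rewrite !subrr.
  have [x xm] := coker_surj (m : coker f); exists (x - f (r x - n)).
  rewrite /= /h ghom_sub rf opprB addrC subrK; congr (_, _).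
  rewrite ghom_sub xm [X in _ - X](_ : _ = 0) ?subr0 //.
  by apply/coker_exact; eexists.
apply: eq_exist; apply/funext => e; apply/propext; split.
  exact/ext_equiv_trans/ext_equiv_sym.
exact: ext_equiv_trans.
Qed.

End Extensions.

(** * The elementary obstruction *)

Section AlgebraicClosure.
Variables (R : rcfType) (C : closedFieldType) (s : {rmorphism R -> C}).
Hypothesis sC : algebraic_closure s.

(** A square root of -1 in C defines R[i] -> C. It is onto because each element of C is a root of a
    real polynomial, which already splits over R[i]. *)
Lemma complex_closure : exists f : {rmorphism R[i] -> C},
  bijective f /\ forall a : R, f (a%:C)%C = s a.
Proof.
have [I II] : exists I : C, I ^+ 2 = -1.
  have [//|I] := @solve_monicpoly C 2 (fun j => if j == 0 then -1 else 0).
  by rewrite !big_ord_recl big_ord0 /= expr0 mulr1 mul0r !addr0; exists I.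
pose f0 (z : R[i]) : C := s (complex.Re z) + I * s (complex.Im z).
have fB : zmod_morphism f0.
  by move=> [a b] [c d]; rewrite /f0 /= !rmorphB /=; ring.
have fM : monoid_morphism f0.
  split=> [|[a b] [c d]]; rewrite /f0 /= ?rmorph1 ?rmorph0 ?mulr0 ?addr0 //.
  rewrite rmorphB rmorphD !rmorphM /=.
  transitivity (s a * s c + I ^+ 2 * (s b * s d) + I * (s a * s d + s b * s c)).
    by rewrite II; ring.
  by ring.
have [f fE] : exists f : {rmorphism R[i] -> C}, forall z, f z = f0 z.
  by exists (HB.pack_for (GRing.RMorphism.type R[i] C) f0
    (GRing.isZmodMorphism.Build _ _ f0 fB) (GRing.isMonoidMorphism.Build _ _ f0 fM)).
have fs a : f (a%:C)%C = s a by rewrite fE /f0 /= rmorph0 mulr0 addr0.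
exists f; split=> //; apply: bijective_of => [|x]; first exact: fmorph_inj.
have [p p0 px] := sC x.
have [r pr] := closed_field_poly_normal (map_poly (real_complex R) p).
have sE : map_poly s p = map_poly f (map_poly (real_complex R) p).
  by rewrite -map_poly_comp; apply: eq_map_poly => a /=; rewrite -fs.
move: px; rewrite sE pr map_polyZ rmorph_prod /= rootZ; last first.
  by rewrite fmorph_eq0 lead_coef_eq0 map_poly_eq0.
under eq_bigr do rewrite rmorphB /= map_polyX map_polyC /=.
rewrite -(big_map f predT (fun z => 'X - z%:P)) root_prod_XsubC.
by case/mapP => z _ ->; exists z.
Qed.

Section Conjugation.
Variable f : {rmorphism R[i] -> C}.
Hypotheses (fb : bijective f) (fs : forall a : R, f (a%:C)%C = s a).

Lemma gal_conj : exists u : Defs.gal s, forall z, val u (f z) = f (conjc z).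
Proof.
have [g fK gK] := fb; pose c0 x := f (conjc (g x)).
have fi := can_inj fK; have gi := can_inj gK.
have gB x y : g (x - y) = g x - g y by apply: fi; rewrite rmorphB !gK.
have gM x y : g (x * y) = g x * g y by apply: fi; rewrite rmorphM !gK.
have g1 : g 1 = 1 by apply: fi; rewrite rmorph1 gK.
have cP : is_gal s c0.
  split.
  - by move=> x y; rewrite /c0 gB !rmorphB.
  - by split=> [|x y]; rewrite /c0 ?g1 ?gM ?rmorph1 ?rmorphM.
  - by exists c0 => x; rewrite /c0 fK conjcK gK.
  - by move=> a; rewrite /c0 -fs fK conjc_real.
by exists (Sub c0 (asboolT cP)) => z; rewrite /= /c0 fK.
Qed.

Lemma gal_cases (u : Defs.gal s) :
  (forall z, val u (f z) = f z) \/ (forall z, val u (f z) = f (conjc z)).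
Proof.
have fE z : f z = s (complex.Re z) + f 'i%C * s (complex.Im z).
  by rewrite {1}[z]complexE rmorphD rmorphM !fs.
have uE z : val u (f z) = s (complex.Re z) + val u (f 'i%C) * s (complex.Im z).
  have [_ _ _ us] := Defs.galP u.
  by rewrite fE -!galXE rmorphD rmorphM !galXE !us.
have : (val u (f 'i%C) - f 'i%C) * (val u (f 'i%C) + f 'i%C) = 0.
  rewrite -subr_sqr -galXE -!rmorphXn sqr_i !rmorphN1 subrr //.
move/eqP; rewrite mulf_eq0 subr_eq0 addr_eq0 => /orP[/eqP uI|/eqP uI].
  by left=> z; rewrite uE uI -fE.
right=> z; rewrite uE uI [RHS]fE.
by case: z => a b /=; rewrite rmorphN mulrN mulNr.
Qed.

End Conjugation.
End AlgebraicClosure.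

(** * The function field L as K(i), and the obstruction in terms of sums of two squares *)

Section FunctionField.
Variables (R : rcfType) (C : closedFieldType) (s : {rmorphism R -> C}).
Variables (X : variety R) (Xg : geom_integral s X).
Variable f : {rmorphism R[i] -> C}.
Hypotheses (fb : bijective f) (fs : forall a : R, f (a%:C)%C = s a).
Local Notation K := (funfield X).
Local Notation L := (geom_funfield Xg).
Local Notation j := (geom_pull Xg).
Local Notation ic := (geom_const Xg).
Local Notation I := (ic (f 'i%C)).

Lemma I_sqr : I * I = -1.
Proof. by rewrite -!rmorphM -expr2 sqr_i !rmorphN1. Qed.

Lemma norm_rect a b : (j a + I * j b) * (j a - I * j b) = j (a ^+ 2 + b ^+ 2).
Proof.
rewrite rmorphD !rmorphXn /=.
by transitivity (j a ^+ 2 - (I * I) * j b ^+ 2); [ring | rewrite I_sqr; ring].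
Qed.

(** The elements of this shape form a subfield containing K and the constants, and L is the fraction
    field of an algebra generated by these. *)
Lemma geom_rect (z : L) : exists a b : K, z = j a + I * j b.
Proof.
pose P z := exists a b : K, z = j a + I * j b.
have PD x y : P x -> P y -> P (x + y).
  move=> [a [b ->]] [c [d ->]]; exists (a + c), (b + d).
  by rewrite !rmorphD mulrDr addrACA.
have PM x y : P x -> P y -> P (x * y).
  move=> [a [b ->]] [c [d ->]]; exists (a * c - b * d), (a * d + b * c).
  rewrite rmorphB rmorphD !rmorphM /=.
  transitivity (j a * j c + (I * I) * (j b * j d) + I * (j a * j d + j b * j c)).
    by ring.
  by rewrite I_sqr; ring.
have Pj a : P (j a) by exists a, 0; rewrite rmorph0 mulr0 addr0.
have PV x : P x -> P x^-1.
  move=> [a [b ->]]; have [->|xn0] := eqVneq (j a + I * j b) 0.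
    by rewrite invr0 -(rmorph0 j).
  (* If the conjugate expression vanishes, then I * j b = j a and the element to invert is j (a +
     a), already in K. *)
  have [ab0|ab0] := eqVneq (j a - I * j b) 0.
    move/eqP: ab0; rewrite subr_eq0 => /eqP <-.
    by rewrite -rmorphD -fmorphV.
  have -> : (j a + I * j b)^-1 = (j a - I * j b) * (j (a ^+ 2 + b ^+ 2))^-1.
    by rewrite -norm_rect invfM mulrCA divff ?mulr1.
  rewrite -fmorphV; apply: PM; last exact: Pj.
  by exists a, (- b); rewrite rmorphN mulrN.
have PC c : P (ic c).
  have [g _ gK] := fb; rewrite -(gK c) [g c]complexE rmorphD rmorphM !fs.
  exists (fconst X (complex.Re (g c))), (fconst X (complex.Im (g c))).
  by rewrite !geom_compat rmorphD rmorphM.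
have /hasP[g gX _] : has predT (atlas X) by rewrite has_predT lt0n size_eq0 atlas_nonempty.
have [x [y [Px Py _ ->]]] := geom_frac gX z.
have PA w : subalg_gen ic (map j g) w -> P w.
  by elim=> // [y' /mapP[y'' _ ->]|y' z' _ Py' _ Pz'|y' z' _ Py' _ Pz'];
    [exact: Pj | exact: PD | exact: PM].
by apply: PM; [|apply: PV]; apply: PA.
Qed.

Lemma gal_act_rect (u : Defs.gal s) a b :
  gal_act Xg u (j a + I * j b) = j a + ic (val u (f 'i%C)) * j b.
Proof.
have [_ _ uj uc] := gal_actP Xg u.
by rewrite -[LHS]/(gal_act_rmorphism Xg u _) rmorphD rmorphM /= !uj uc.
Qed.

Lemma ob_zero_sum2 :
  ob Xg = Ext1_zero _ _ <-> ~ exists x y : K, x ^+ 2 + y ^+ 2 = -1.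
Proof.
rewrite /ob coker_split; have [u uf] := gal_conj fb fs.
have ui : val u (f 'i%C) = - f 'i%C.
  by rewrite uf -rmorphN; congr (f _); apply/eqP; rewrite eq_complex /= oppr0 !eqxx.
have ut a b : gal_act Xg u (j a + I * j b) = j a - I * j b.
  by rewrite gal_act_rect ui rmorphN mulNr.
split=> [[r rc] [x [y xy]]|nxy].
  have zt : (j x + I * j y) * gal_act Xg u (j x + I * j y) = -1.
    by rewrite ut norm_rect xy rmorphN1.
  have z0 : j x + I * j y != 0.
    by apply: contra_eq_neq zt => ->; rewrite mul0r eq_sym oppr_eq0 oner_eq0.
  have m0 : -1 != 0 :> C by rewrite oppr_eq0 oner_eq0.
  pose z : fun_units Xg := to_munit z0; pose m : const_units s := to_munit m0.
  (* In the additive notation for units, z - (- gact u z) is the product of z and its conjugate.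
     Applying r makes -1 equal to the squared modulus of r z. *)
  have zm : const_incl Xg m = z - (- gact u z).
    by apply/val_inj; rewrite opprK /= rmorphN1; apply/esym.
  have := rc m; rewrite zm ghom_sub -[- gact u z]sub0r ghom_sub.
  have r0 : r 0 = 0 by have := ghom_sub r 0 0; rewrite !subrr.
  rewrite r0 sub0r opprK ghom_act => /(congr1 val) /=.
  have [g _ gK] := fb; rewrite -(gK (val (r z))) uf -rmorphM => /eqP.
  rewrite -(rmorphN1 f) (inj_eq (fmorph_inj f)) => /eqP nz.
  by have := mulcJ_ge0 (g (val (r z))); rewrite nz oppr_ge0 ler10.
have [|c|w|r [rB rc rt]] := @equivariant_retraction _ _
    (GRing.RMorphism.clone _ _ (ic \o f) _) (gal_act_rmorphism Xg u).
- move=> z /=; have [a [b ->]] := geom_rect z.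
  by rewrite ut -mulrN -rmorphN ut rmorphN mulrN opprK.
- have [_ _ _ uc] := gal_actP Xg u.
  by rewrite /= uc uf.
- have [a [b ->]] := geom_rect w; rewrite /= ut norm_rect -(rmorphN1 j).
  rewrite (inj_eq (fmorph_inj j)); apply/eqP => ab; apply: nxy; by exists a, b.
pose r' (x : fun_units Xg) : const_units s := munit_map f (r x).
have r'B : zmod_morphism r' by move=> x y; rewrite /r' rB munit_map_sub.
(* The construction gives equivariance under conjugation only; by [gal_cases] the remaining elements
   of the Galois group act trivially. *)
have r'a v x : r' (gact v x) = gact v (r' x).
  apply/val_inj => /=; have [vf|vf] := gal_cases fs v.
    rewrite vf; congr (f (val (r _))); apply/val_inj => /=.
    by have [a [b ->]] := geom_rect (val x); rewrite gal_act_rect vf.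
  rewrite vf -[conjc _]rt; congr (f (val (r _))); apply/val_inj => /=.
  by have [a [b ->]] := geom_rect (val x); rewrite !gal_act_rect vf uf.
exists (GHom r'B r'a) => c; apply/val_inj => /=.
have [g _ gK] := fb.
have gc0 : g (val c) != 0 by rewrite -(fmorph_eq0 f) gK (valP c).
have -> : munit_map ic c = munit_map (GRing.RMorphism.clone _ _ (ic \o f) _) (to_munit gc0).
  by apply/val_inj; rewrite /= gK.
by rewrite rc /= gK.
Qed.

End FunctionField.

Theorem theorem2p6 (R : rcfType) (C : closedFieldType) (s : {rmorphism R -> C})
    (sC : algebraic_closure s) (X : variety R) (Xg : geom_integral s X) :
  ob Xg = Ext1_zero _ _ <-> brauer_injective (fconst X).
Proof.
have [f [fb fs]] := complex_closure sC.
by rewrite brauer_injective_sum2; apply: ob_zero_sum2 fb fs.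
Qed.
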